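(* Let $K\ge1$ be fixed, let $\boldsymbol{\beta}_0\in\mathbb{R}^K$, and for each $n$ let $\mathbf{x}_1,\dots,\mathbf{x}_n\in\mathbb{R}^K$ (rows of the $n\times K$ design matrix $\mathbf{X}$) satisfy: (i) $\sum_{i=1}^n x_{i,k}=0$ and $\sum_{i=1}^n x_{i,k}^2=n$ for each $k$; (ii) $\max_{1\le i\le n}\|\mathbf{x}_i\|/\sqrt n\to0$; (iii) $\mathbf{X}^t\mathbf{X}$ is positive definite; (iv) $\mathbf{X}^t\mathbf{X}/n\to\boldsymbol{\Sigma}_0$ with $\boldsymbol{\Sigma}_0$ positive definite. Suppose $Y_{ni}=\mathbf{x}_i^t\boldsymbol{\beta}_0/\sqrt n+\varepsilon_{ni}$, $i=1,\dots,n$, where for each $n$ the $\varepsilon_{n1},\dots,\varepsilon_{nn}$ are independent with $\mathbb{E}(\varepsilon_{ni})=0$, $\mathbb{E}(\varepsilon_{ni}^2)=1$ and $\mathbb{E}(\varepsilon_{ni}^4)\le M$ for some $M<\infty$. Let $Y_{ni}^*=\sqrt n\,Y_{ni}$, $\mathbf{Y}_n^*=(Y_{n1}^*,\dots,Y_{nn}^* )^t$, and fix $\boldsymbol{\gamma}_0=(\gamma_{1,0},\dots,\gamma_{K,0})^t$ with all $\gamma_{k,0}>0$ and $\boldsymbol{\Gamma}_0=\mathrm{diag}(\boldsymbol{\gamma}_0)$. In the Bayesian model $(Y_{ni}^*\mid\mathbf{x}_i,\boldsymbol{\beta})$ independent $N(\mathbf{x}_i^t\boldsymbol{\beta},n)$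 with prior $\boldsymbol{\beta}\sim N(\mathbf{0},\boldsymbol{\Gamma}_0)$, let $\widehat{\boldsymbol{\beta}}_{nn}^*(\boldsymbol{\gamma}_0)=\mathbb{E}(\boldsymbol{\beta}\mid\boldsymbol{\gamma}_0,\mathbf{Y}_n^* )$ be the posterior mean. Then $\widehat{\boldsymbol{\beta}}_{nn}^*(\boldsymbol{\gamma}_0)$ converges in distribution to $Q(\cdot\mid\boldsymbol{\gamma}_0)$, the law of $(\boldsymbol{\Sigma}_0+\boldsymbol{\Gamma}_0^{-1})^{-1}(\boldsymbol{\Sigma}_0\boldsymbol{\beta}_0+\mathbf{Z})$ with $\mathbf{Z}\sim N(\mathbf{0},\boldsymbol{\Sigma}_0)$.
   Context: $\|\cdot\|$ is the Euclidean norm. Equivalently, $Q(\cdot\mid\boldsymbol{\gamma}_0)$ is a normal distribution with mean $\mathbf{V}_0^{-1}\boldsymbol{\beta}_0$, where $\mathbf{V}_0=\mathbf{I}+\boldsymbol{\Sigma}_0^{-1}\boldsymbol{\Gamma}_0^{-1}$, and covariance $(\boldsymbol{\Sigma}_0+\boldsymbol{\Gamma}_0^{-1})^{-1}\boldsymbol{\Sigma}_0(\boldsymbol{\Sigma}_0+\boldsymbol{\Gamma}_0^{-1})^{-1}$. *)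

(* Defs.v *)
From HB Require Import structures.
From mathcomp Require Import all_boot all_order all_algebra.
From mathcomp Require Import all_classical all_reals all_analysis.
Set Implicit Arguments. Unset Strict Implicit. Unset Printing Implicit Defensive.
Import Order.TTheory GRing.Theory Num.Theory.
Import numFieldTopology.Exports numFieldNormedType.Exports.
Local Open Scope classical_set_scope.
Local Open Scope ring_scope.

Section defs.
Variable R : realType.

Definition posdef (K : nat) (A : 'M[R]_K) : Prop :=
  A^T = A /\ forall u : 'cV[R]_K, u != 0 -> 0 < (u^T *m A *m u) 0 0.

Definition eucl_norm (K : nat) (x : 'rV[R]_K) : R :=
  Num.sqrt (\sum_(k < K) x 0 k ^+ 2).

Definition max_row_ratio (n K : nat) (X : 'M[R]_(n, K)) : R :=
  \big[Num.max/0]_(i < n) (eucl_norm (row i X) / Num.sqrt n%:R).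

(* Mutual independence of a finite family of real random variables:
   product rule for every choice of Borel sets (taking B i = setT recovers
   the product rule for every subfamily). *)
Definition mutually_independent d (T : measurableType d) (P : probability T R)
  (n : nat) (Xs : 'I_n -> T -> R) : Prop :=
  forall B : 'I_n -> set R, (forall i, measurable (B i)) ->
    P (\bigcap_(i in [set: 'I_n]) (Xs i @^-1` B i)) =
    (\prod_(i < n) P (Xs i @^-1` B i))%E.

(* Z is a centred Gaussian random vector with covariance Sigma
   (every nontrivial linear combination u^t Z is N(0, u^t Sigma u);
   normal_prob m s has mean m and standard deviation s). *)
Definition gaussian_vector d (T : measurableType d) (Q : probability T R)
  (K : nat) (Z : T -> 'cV[R]_K) (Sigma : 'M[R]_K) : Prop :=
  (forall k, measurable_fun setT (fun w => Z w k 0)) /\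
  forall u : 'cV[R]_K, u != 0 -> forall A : set R, measurable A ->
    Q ((fun w => (u^T *m Z w) 0 0) @^-1` A) =
    normal_prob 0 (Num.sqrt ((u^T *m Sigma *m u) 0 0)) A.

Definition cvg_in_distribution (K : nat) (d : nat -> measure_display)
  (Omega : forall n, measurableType (d n)) (P : forall n, probability (Omega n) R)
  (Xn : forall n, Omega n -> 'cV[R]_K)
  d' (Omega' : measurableType d') (Q : probability Omega' R)
  (L : Omega' -> 'cV[R]_K) : Prop :=
  forall f : 'cV[R]_K -> R, continuous f -> (exists C : R, forall v, `|f v| <= C) ->
    (fun n => \int[P n]_w (f (Xn n w))%:E)%E @ \oo --> (\int[Q]_w (f (L w))%:E)%E.

(* Prior beta ~ N(0, diag gamma): expectation of g(beta), computed as the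
   iterated integral over the independent coordinates beta_k ~ N(0, gamma_k)
   (standard deviation sqrt gamma_k). *)
Fixpoint prior_iint (K : nat) (gamma : 'cV[R]_K) (s : seq 'I_K)
  (g : ('I_K -> R) -> \bar R) (b : 'I_K -> R) : \bar R :=
  match s with
  | [::] => g b
  | k :: s' => (\int[normal_prob 0 (Num.sqrt (gamma k ord0))]_t
                 prior_iint gamma s' g (fun j => if j == k then t else b j))%E
  end.

Definition prior_expect (K : nat) (gamma : 'cV[R]_K) (h : 'cV[R]_K -> R) : \bar R :=
  prior_iint gamma (enum 'I_K) (fun b => (h (\col_k b k))%:E) (fun _ => 0).

Definition likelihood (n K : nat) (X : 'M[R]_(n, K)) (v : R) (y : 'cV[R]_n)
  (beta : 'cV[R]_K) : R :=
  \prod_(i < n) normal_pdf ((X *m beta) i 0) (Num.sqrt v) (y i 0).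

Definition posterior_mean (n K : nat) (X : 'M[R]_(n, K)) (v : R) (gamma : 'cV[R]_K)
  (y : 'cV[R]_n) : 'cV[R]_K :=
  \col_k (fine (prior_expect gamma (fun beta => beta k 0 * likelihood X v y beta))
          / fine (prior_expect gamma (likelihood X v y))).

End defs.

(* Main.v *)
Require Import Defs.
From HB Require Import structures.
From mathcomp Require Import all_boot all_order all_algebra.
From mathcomp Require Import all_classical all_reals all_analysis.
From mathcomp Require Import measurable_realfun.
From mathcomp Require Import ring lra.
Import Order.TTheory GRing.Theory Num.Theory.
Import numFieldTopology.Exports numFieldNormedType.Exports.
Local Open Scope classical_set_scope.
Local Open Scope ring_scope.
Set Implicit Arguments. Unset Strict Implicit. Unset Printing Implicit Defensive.

(** The joint density of [(y, beta)] is symmetric in [beta] about the solution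
    [m] of the ridge normal equations, and the reflection [b |-> 2 m - b]
    changes the prior only by a ratio of densities.  Hence the posterior mean is
    [m = (X^T X / n + Gamma^-1)^-1 X^T y / n], and each linear functional of it
    is a constant plus a weighted sum of the errors.  Lindeberg replacement, one
    summand at a time, compares [E cos (c + sum_i a_i eps_i)] with the Gaussian
    value [cos c * exp (- sum_i a_i^2 / 2)]; the error is [O(sum_i |a_i|^3)],
    which vanishes because the rows of the design are negligible.  Finally,
    bounded second moments and convergence of [E cos (c + u^T X_n)] for all [c]
    and [u] imply convergence in distribution: the uniform closure of the
    trigonometric polynomials is a lattice, so a bounded continuous function is
    approximated on a large box by a trigonometric polynomial with nearly the
    same global bound. *)

(** Cosines with a free phase [c] stand in for the complex characteristic function: [c = - pi / 2]
    yields sines, so nothing is lost and all integrals stay real. The Gaussian side enters the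
    replacement only through numbers [expR (- (t ^+ 2 / 2))]; no Gaussian copies of the errors are
    built. The fourth moment serves twice: it bounds the remainder of the cosine expansion and,
    through [2 |x|^3 <= x^2 + x^4], that of the sine. The obstacle in passing from trigonometric
    polynomials to bounded continuous functions is the tail: an approximant that is good on a box of
    radius [r] may be huge outside it. Second moments give a tail mass of order [1 / r^2], which
    helps only if the sup norm of the approximant does not depend on [r]. Working with maxima and
    minima permits truncation at the bound of [f], and this is what controls that norm. The
    reflection argument avoids evaluating a multivariate Gaussian integral: it acts on the iterated
    prior integral one coordinate at a time. *)

(** * Taylor inequalities for the sine, cosine and exponential *)

Section trigonometric_bounds.
Variable R : realType.
Implicit Types x y : R.

(** By the mean value theorem. Starting from [cos x <= 1], repeated use gives each sine or cosine
    bound below from the previous one; parity takes care of negative arguments. *)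
Lemma ge0_is_derive_ge0 (f df : R -> R) :
  (forall x, is_derive x 1 f (df x)) -> f 0 = 0 ->
  (forall x, 0 <= x -> 0 <= df x) -> forall x, 0 <= x -> 0 <= f x.
Proof.
move=> fdf f0 df0 x x0.
have [|c + E] := @MVT_segment R f df 0 x x0 (fun y _ => fdf y).
  apply: continuous_subspaceT => y; apply: differentiable_continuous.
  by apply/derivable1_diffP; case: (fdf y).
rewrite in_itv/= => /andP[c0 _].
by move: E; rewrite f0 !subr0 => ->; rewrite mulr_ge0// df0.
Qed.

Lemma sin_le_id x : 0 <= x -> sin x <= x.
Proof.
move=> x0; rewrite -subr_ge0; move: x x0; apply: (@ge0_is_derive_ge0 (fun x => x - sin x) (fun x => 1 - cos x)).
- by rewrite sin0 subr0.
- by move=> y _; rewrite subr_ge0 cos_le1.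
Qed.

Lemma cos_ge_quadratic x : 1 - x ^+ 2 / 2 <= cos x.
Proof.
have H y : 0 <= y -> 0 <= cos y - (1 - y ^+ 2 / 2).
  apply: (@ge0_is_derive_ge0 (fun x => cos x - (1 - x ^+ 2 / 2)) (fun x => x - sin x)).
  - move=> z; apply: is_derive_eq; rewrite /GRing.scale/=; by field.
  - by rewrite cos0 expr0n/= mul0r !subr0 subrr.
  - by move=> z z0; rewrite subr_ge0 sin_le_id.
rewrite -subr_ge0; have [x0|x0] := leP 0 x; first exact: H.
by rewrite -cosN -sqrrN; apply: H; rewrite oppr_ge0 ltW.
Qed.

Lemma sin_ge_cubic x : 0 <= x -> x - x ^+ 3 / 6 <= sin x.
Proof.
move=> x0; rewrite -subr_ge0; move: x x0; apply: (@ge0_is_derive_ge0 (fun x => sin x - (x - x ^+ 3 / 6)) (fun x => cos x - (1 - x ^+ 2 / 2))).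
- move=> z; apply: is_derive_eq; rewrite /GRing.scale/=; by field.
- by rewrite sin0 expr0n/= mul0r !subr0.
- by move=> z z0; rewrite subr_ge0 cos_ge_quadratic.
Qed.

Lemma cos_le_quartic x : cos x <= 1 - x ^+ 2 / 2 + x ^+ 4 / 24.
Proof.
have H y : 0 <= y -> 0 <= 1 - y ^+ 2 / 2 + y ^+ 4 / 24 - cos y.
  apply: (@ge0_is_derive_ge0 (fun x => 1 - x ^+ 2 / 2 + x ^+ 4 / 24 - cos x) (fun x => sin x - (x - x ^+ 3 / 6))).
  - move=> z; apply: is_derive_eq; rewrite /GRing.scale/=; by field.
  - by rewrite cos0 !expr0n/= !mul0r addr0 subr0 subrr.
  - by move=> z z0; rewrite subr_ge0 sin_ge_cubic.
rewrite -subr_ge0; have [x0|x0] := leP 0 x; first exact: H.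
rewrite -cosN -sqrrN -[x ^+ 4](_ : (- x) ^+ 4 = _); last by ring.
by apply: H; rewrite oppr_ge0 ltW.
Qed.

Lemma sin_sub_id_le x : `|sin x - x| <= `|x| ^+ 3 / 6.
Proof.
have H y : 0 <= y -> `|sin y - y| <= `|y| ^+ 3 / 6.
  move=> y0; rewrite (ger0_norm y0) ler_norml.
  have := sin_le_id y0; have := sin_ge_cubic y0.
  have : 0 <= y ^+ 3 by rewrite exprn_ge0.
  by move=> *; apply/andP; split; lra.
have [x0|x0] := leP 0 x; first exact: H.
have := H (- x); rewrite oppr_ge0 sinN -opprD !normrN; apply; exact: ltW.
Qed.

Lemma expRN_sub_affine_le x : 0 <= x -> `|expR (- x) - (1 - x)| <= x ^+ 2 / 2.
Proof.
move=> x0; have A : 1 - x <= expR (- x) by exact: expR_ge1Dx.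
rewrite ger0_norm ?subr_ge0// -subr_ge0.
apply: (@ge0_is_derive_ge0 (fun x => x ^+ 2 / 2 - (expR (- x) - (1 - x))) (fun x => x + expR (- x) - 1)) => //.
- move=> z; apply: is_derive_eq; rewrite /GRing.scale/=; by field.
- by rewrite oppr0 expR0 expr0n/= mul0r addr0 !subrr.
- by move=> z z0; have := expR_ge1Dx (- z); lra.
Qed.

End trigonometric_bounds.

(** * The centred normal distribution *)

Section normal_change_of_variables.
Variable R : realType.
Notation mu := (@lebesgue_measure R).
Implicit Types (c s t m : R).

Lemma measurable_cos_comp d (T : measurableType d) (f : T -> R) :
  measurable_fun setT f -> measurable_fun setT (fun x => cos (f x)).
Proof.
move=> mf; apply: (measurableT_comp _ mf).
by apply: continuous_measurable_fun; exact: continuous_cos.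
Qed.

Lemma measurable_sin_comp d (T : measurableType d) (f : T -> R) :
  measurable_fun setT f -> measurable_fun setT (fun x => sin (f x)).
Proof.
move=> mf; apply: (measurableT_comp _ mf).
by apply: continuous_measurable_fun; exact: continuous_sin.
Qed.

(** The Radon-Nikodym derivative of [normal_prob] and the explicit density have the same integral
    over every measurable set, so they agree almost everywhere and can be exchanged under the
    integral. *)
Lemma ge0_integral_normal_prob m s (f : R -> \bar R) :
  measurable_fun setT f -> (forall x, 0 <= f x)%E ->
  (\int[normal_prob m s]_x f x = \int[mu]_x (f x * (normal_pdf m s x)%:E))%E.
Proof.
move=> mf f0; have dom := normal_prob_dominates m s.
have mp : measurable_fun setT (fun x => (normal_pdf m s x)%:E).
  by apply/measurable_EFinP; exact: measurable_normal_pdf.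
have mRN := measurable_int _ (Radon_Nikodym_SigmaFinite.f_integrable dom).
rewrite -(Radon_Nikodym_SigmaFinite.change_of_variables dom)//.
apply: ge0_ae_eq_integral => //.
- exact: emeasurable_funM.
- exact: emeasurable_funM.
- by move=> x _; rewrite mule_ge0// Radon_Nikodym_SigmaFinite.f_ge0.
- by move=> x _; rewrite mule_ge0// lee_fin normal_pdf_ge0.
apply: ae_eqe_mul2l; apply: integral_ae_eq => //.
- exact: Radon_Nikodym_SigmaFinite.f_integrable.
- by move=> E _ mE; rewrite -(Radon_Nikodym_SigmaFinite.f_integral dom).
Qed.

(** The image measure agrees with length on half-open intervals, which determines Lebesgue measure.
    Reflection moves the closed end to the other side, without effect on the length. *)
Lemma lebesgue_measure_reflect c (A : set R) : measurable A ->
  mu ((fun x => c - x) @^-1` A) = mu A.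
Proof.
move=> mA; have mphi : @measurable_fun _ _ (measurableTypeR R) (measurableTypeR R) setT (fun x : R => c - x).
  exact: measurable_funB.
pose nu : {measure set (measurableTypeR R) -> \bar R} :=
  measure_function_pushforward__canonical__measure_function_Measure mu mphi.
rewrite -[LHS]/(nu A); apply/esym/lebesgue_measure_unique => // X /ocitvP[->|[[a b]/= ab ->]].
  by rewrite !measure0.
rewrite -[RHS]/(mu ((fun x => c - x) @^-1` _)).
rewrite (_ : _ @^-1` _ = `[c - b, c - a[%classic); last first.
  by apply/seteqP; split => x; rewrite /= !in_itv/= => /andP[? ?]; apply/andP; split; lra.
rewrite !lebesgue_measure_itv/= !lte_fin ab (_ : c - b < c - a); last by lra.
by rewrite -!EFinB; congr EFin; ring.
Qed.

Lemma lebesgue_measure_shift c (A : set R) : measurable A ->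
  mu ((fun x => x + c) @^-1` A) = mu A.
Proof.
move=> mA; have mphi : @measurable_fun _ _ (measurableTypeR R) (measurableTypeR R) setT (fun x : R => x + c).
  exact: measurable_funD.
pose nu : {measure set (measurableTypeR R) -> \bar R} :=
  measure_function_pushforward__canonical__measure_function_Measure mu mphi.
rewrite -[LHS]/(nu A); apply/esym/lebesgue_measure_unique => // X /ocitvP[->|[[a b]/= ab ->]].
  by rewrite !measure0.
rewrite -[RHS]/(mu ((fun x => x + c) @^-1` _)).
rewrite (_ : _ @^-1` _ = `]a - c, b - c]%classic); last first.
  by apply/seteqP; split => x; rewrite /= !in_itv/= => /andP[? ?]; apply/andP; split; lra.
rewrite !lebesgue_measure_itv/= !lte_fin ab (_ : a - c < b - c); last by lra.
by rewrite -!EFinB; congr EFin; ring.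
Qed.

(** The exponential is the quotient of the densities at [phi x] and at [x]. A shift gives the
    Cameron-Martin formula, a reflection the factor by which the prior changes. *)
Lemma ge0_integral_normal_prob_change s (phi : R -> R) (f : R -> \bar R) :
  s != 0 -> measurable_fun setT phi ->
  (forall A : set R, measurable A -> mu (phi @^-1` A) = mu A) ->
  measurable_fun setT f -> (forall x, 0 <= f x)%E ->
  (\int[normal_prob 0 s]_x f x = \int[normal_prob 0 s]_x
     (f (phi x) * (expR ((x ^+ 2 - phi x ^+ 2) / (s ^+ 2 *+ 2)))%:E))%E.
Proof.
move=> s0 mphi muphi mf f0.
have mp : measurable_fun setT (fun x => (normal_pdf 0 s x)%:E).
  by apply/measurable_EFinP; exact: measurable_normal_pdf.
have mfp : measurable_fun setT (f \o phi) by exact: measurableT_comp.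
have me : measurable_fun setT
    (fun x : R => (expR ((x ^+ 2 - phi x ^+ 2) / (s ^+ 2 *+ 2)))%:E).
  apply/measurable_EFinP; apply: measurableT_comp => //.
  apply: measurable_funM => //; apply: measurable_funB; exact: measurable_funX.
rewrite !ge0_integral_normal_prob//; last 2 first.
- exact: emeasurable_funM.
- by move=> x; rewrite mule_ge0// lee_fin expR_ge0.
have mphi' : @measurable_fun _ _ (measurableTypeR R) (measurableTypeR R) setT phi by [].
pose nu : {measure set (measurableTypeR R) -> \bar R} :=
  measure_function_pushforward__canonical__measure_function_Measure mu mphi'.
transitivity (\int[nu]_x (f x * (normal_pdf 0 s x)%:E))%E.
  by apply: eq_measure_integral => A mA _; rewrite /nu/= /pushforward muphi.
rewrite (ge0_integral_pushforward mphi')//; last 2 first.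
- exact: emeasurable_funM.
- by move=> x _; rewrite mule_ge0// lee_fin normal_pdf_ge0.
rewrite preimage_setT; apply: eq_integral => x _ /=.
rewrite -muleA -EFinM; congr (_ * _%:E)%E.
rewrite !normal_pdfE// mulrCA; congr (_ * _); rewrite /normal_fun -expRD !subr0.
congr expR; rewrite -mulrDl; congr (_ / _); ring.
Qed.

(** The exponential factor is positive, hence commutes with positive and negative parts, and the
    nonnegative case applies to each of them. *)
Lemma integral_normal_prob_change s (phi : R -> R) (f : R -> R) :
  s != 0 -> measurable_fun setT phi ->
  (forall A : set R, measurable A -> mu (phi @^-1` A) = mu A) ->
  measurable_fun setT f ->
  (\int[normal_prob 0 s]_x (f x)%:E = \int[normal_prob 0 s]_x
     (f (phi x) * expR ((x ^+ 2 - phi x ^+ 2) / (s ^+ 2 *+ 2)))%:E)%E.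
Proof.
move=> s0 mphi muphi mf; rewrite [LHS]integralE [RHS]integralE.
have mfE : measurable_fun setT (EFin \o f) by exact/measurable_EFinP.
congr (_ - _)%E.
- rewrite (@ge0_integral_normal_prob_change s phi (fun x => (EFin \o f)^\+ x)%E)//.
  + apply: eq_integral => x _; rewrite !funeposE/= -EFin_max -!EFin_max -EFinM.
    by rewrite maxr_pMl ?expR_ge0// mul0r.
  + exact: measurable_funepos.
- rewrite (@ge0_integral_normal_prob_change s phi (fun x => (EFin \o f)^\- x)%E)//.
  + apply: eq_integral => x _; rewrite !funenegE/= -!EFin_max -EFinM.
    by rewrite maxr_pMl ?expR_ge0// mul0r mulNr.
  + exact: measurable_funeneg.
Qed.

End normal_change_of_variables.

(** * Cosine transform of the centred normal law *)

Section normal_characteristic_function.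
Variables (R : realType) (s : R).
Hypothesis s0 : s != 0.
Notation N := (normal_prob 0 s).
Implicit Types (a t x : R).

Let N1 : N setT = 1%E. Proof. exact: probability_setT. Qed.

Let mexp a : measurable_fun setT (fun x : R => expR (a * x)).
Proof. by apply: measurableT_comp => //; exact: measurable_funM. Qed.

Let mshift c : measurable_fun [set: R] (fun x : R => x + c).
Proof. exact: measurable_funD. Qed.

(** The shift by [a * s ^+ 2] completes the square: the density ratio cancels the dependence on [x]
    and leaves a constant integrand. *)
Lemma normal_prob_mgf a :
  (\int[N]_x (expR (a * x))%:E = (expR (a ^+ 2 * s ^+ 2 / 2))%:E)%E.
Proof.
have := integral_normal_prob_change s0 (mshift (a * s ^+ 2))
  (@lebesgue_measure_shift R _) (f := fun x => expR (a * x)).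
move=> -> //.
rewrite (eq_integral (fun=> (expR (a ^+ 2 * s ^+ 2 / 2))%:E)).
  by rewrite integral_cst//= N1 mule1.
by move=> x _; congr EFin; rewrite -expRD; congr expR; field.
Qed.

Lemma normal_prob_integrable_expR a :
  N.-integrable setT (EFin \o (fun x : R => expR (a * x))).
Proof.
apply/integrableP; split.
  by apply/measurable_EFinP; exact: mexp.
under eq_integral do rewrite /= ger0_norm ?expR_ge0//.
by rewrite normal_prob_mgf ltry.
Qed.

(** A majorant free of [a], as differentiation under the integral demands; [a = 0] covers the first
    moment. *)
Lemma norm_mulr_expR_le a x : `|a| <= 1 ->
  `|x| * expR (a * x) <= expR (2 * x) + expR (- 2 * x).
Proof.
move=> a1; apply: (@le_trans _ _ (expR `|x| * expR `|x|)).
  apply: ler_pM => //; rewrite ?expR_ge0//.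
    by apply: le_trans (expR_ge1Dx _); rewrite lerDr.
  rewrite ler_expR; apply: le_trans (ler_norm _) _.
  by rewrite normrM ler_piMl.
rewrite -expRD; have [x0|x0] := leP 0 x; rewrite ?(ger0_norm x0) ?(ltr0_norm x0).
  by rewrite [x + x](_ : _ = 2 * x) ?lerDl ?expR_ge0//; ring.
by rewrite [- x - x](_ : _ = - 2 * x) ?lerDr ?expR_ge0//; ring.
Qed.

Let G x := expR (2 * x) + expR (- 2 * x).

Let G_ge0 x : 0 <= G x. Proof. by rewrite addr_ge0 ?expR_ge0. Qed.

Let intG : N.-integrable setT (EFin \o G).
Proof.
rewrite /G /comp; under eq_fun do rewrite EFinD.
by apply: integrableD => //; exact: normal_prob_integrable_expR.
Qed.

Let intG_le (f : R -> R) : measurable_fun setT f ->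
  (forall x, `|f x| <= G x) -> N.-integrable setT (EFin \o f).
Proof.
move=> mf fG; apply: (le_integrable measurableT _ _ intG).
  exact/measurable_EFinP.
by move=> x _ /=; rewrite lee_fin (ger0_norm (G_ge0 x)).
Qed.

Lemma normal_prob_integrable_id : N.-integrable setT (fun x => x%:E).
Proof.
apply: (@intG_le id) => // x.
by have := @norm_mulr_expR_le 0 x; rewrite normr0 mul0r expR0 mulr1; exact.
Qed.

Lemma normal_prob_integrable_bounded (f : R -> R) (C : R) :
  measurable_fun setT f -> (forall x, `|f x| <= C) ->
  N.-integrable setT (EFin \o f).
Proof.
move=> mf fC; apply: (@le_integrable _ _ _ _ _ measurableT _ (fun=> C%:E)).
- exact/measurable_EFinP.
- move=> x _; rewrite /= lee_fin; apply: le_trans (fC x) _; exact: ler_norm.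
- exact: finite_measure_integrable_cst.
Qed.

Let mcos t : measurable_fun setT (fun x : R => cos (t * x)).
Proof. by apply: measurable_cos_comp; exact: measurable_funM. Qed.

Let msin t : measurable_fun setT (fun x : R => sin (t * x)).
Proof. by apply: measurable_sin_comp; exact: measurable_funM. Qed.

Let sin_norm_le1 (x : R) : `|sin x| <= 1.
Proof. by rewrite ler_norml sin_geN1 sin_le1. Qed.

Let cos_norm_le1 (x : R) : `|cos x| <= 1.
Proof. by rewrite ler_norml cos_geN1 cos_le1. Qed.

Lemma normal_prob_sin t : \int[N]_x sin (t * x) = 0.
Proof.
have int : N.-integrable setT (EFin \o (fun x => sin (t * x))).
  exact: (@normal_prob_integrable_bounded _ 1).
suff : \int[N]_x sin (t * x) = - \int[N]_x sin (t * x) by lra.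
have mrefl : measurable_fun [set: R] (fun x : R => 0 - x) by exact: measurable_funB.
rewrite {1}/Rintegral (integral_normal_prob_change s0 mrefl
  (@lebesgue_measure_reflect R _) (f := fun x => sin (t * x)))//.
rewrite -[RHS]mulN1r -RintegralZl//; congr fine; apply: eq_integral => x _.
by rewrite sub0r mulrN sinN sqrrN subrr mul0r expR0 mulr1 mulN1r.
Qed.

Let msinexp t a : measurable_fun setT (fun x : R => sin (t * x) * expR (a * x)).
Proof. exact: measurable_funM. Qed.

Lemma normal_prob_sin_tilt t a :
  \int[N]_x (sin (t * x) * expR (a * x)) =
  expR (a ^+ 2 * s ^+ 2 / 2) * sin (t * (a * s ^+ 2)) * \int[N]_x cos (t * x).
Proof.
rewrite {1}/Rintegral (integral_normal_prob_change s0 (mshift (a * s ^+ 2))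
  (@lebesgue_measure_shift R _) (msinexp t a)).
have ic : N.-integrable setT (EFin \o (fun x => cos (t * x))).
  exact: (@normal_prob_integrable_bounded _ 1).
have isn : N.-integrable setT (EFin \o (fun x => sin (t * x))).
  exact: (@normal_prob_integrable_bounded _ 1).
set E := expR (a ^+ 2 * s ^+ 2 / 2).
transitivity (\int[N]_x (E * cos (t * (a * s ^+ 2)) * sin (t * x)
                     + E * sin (t * (a * s ^+ 2)) * cos (t * x))).
  congr fine; apply: eq_integral => x _; congr EFin.
  rewrite -mulrA -expRD [X in expR X](_ : _ = a ^+ 2 * s ^+ 2 / 2); last by field.
  by rewrite -/E mulrDr sinD; ring.
rewrite RintegralD//; first by rewrite !RintegralZl// normal_prob_sin mulr0 add0r.
- by rewrite /comp; under eq_fun do rewrite EFinM; exact: integrableZl.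
- by rewrite /comp; under eq_fun do rewrite EFinM; exact: integrableZl.
Qed.

(** Gaussian integration by parts, obtained by differentiating [normal_prob_sin_tilt] in the tilt
    [a] at 0. On the left this brings down a factor [x]; on the right only the derivative of the
    sine survives, since the sine vanishes at 0. *)
Lemma normal_prob_stein_sin t :
  \int[N]_x (x * sin (t * x)) = t * s ^+ 2 * \int[N]_x cos (t * x).
Proof.
pose f a x : R := sin (t * x) * expR (a * x).
have fD (a y : R) : is_derive a 1 (f ^~ y) (y * f a y).
  by rewrite /f; apply: is_derive_eq; rewrite /GRing.scale/=; ring.
have d1E (a y : R) : partial1of2 f a y = y * f a y.
  by rewrite partial1of2E derive_val.
have I0 : `]-1, 1[%classic (0 : R) by rewrite /= in_itv/=; apply/andP; split; lra.
have bnd (a y : R) : `|a| <= 1 -> `|y * f a y| <= G y.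
  move=> a1; apply: le_trans (norm_mulr_expR_le y a1).
  rewrite !normrM [`|expR _|]ger0_norm ?expR_ge0// ler_wpM2l//.
  by rewrite ler_piMl// expR_ge0.
have := @differentiation_under_integral R _ _ N f setT measurableT 0 (-1) 1 I0.
move=> /(_ _ _ G G_ge0 intG).
have H1 : forall x, `]-1, 1[%classic x -> N.-integrable setT (EFin \o f x).
  move=> a _; apply: (le_integrable measurableT _ _ (normal_prob_integrable_expR a)).
    by apply/measurable_EFinP; exact: msinexp.
  move=> x _ /=; rewrite lee_fin /f normrM ler_piMl//.
have H2 : forall x y, `]-1, 1[%classic x -> setT y -> derivable (f ^~ y) x 1.
  by move=> x y _ _; have [] := fD x y.
have H3 : forall x y, `]-1, 1[%classic x -> setT y -> `|partial1of2 f x y| <= G y.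
  move=> x y; rewrite /= in_itv/= => /andP[x1 x2] _; rewrite d1E bnd//.
  by rewrite ler_norml !ltW.
move=> /(_ H1 H2 H3).
have -> : \int[N]_y partial1of2 f 0 y = \int[N]_x (x * sin (t * x)).
  by apply: eq_Rintegral => x _; rewrite d1E /f mul0r expR0 mulr1.
move=> <-; rewrite (_ : (fun a => \int[N]_y f a y) = fun a =>
  expR (a ^+ 2 * s ^+ 2 / 2) * sin (t * (a * s ^+ 2)) * \int[N]_x cos (t * x)); last first.
  by apply/funext => a; exact: normal_prob_sin_tilt.
rewrite derive1E.
set phi := \int[N]_x _.
have -> : 'D_1 (fun a : R => expR (a ^+ 2 * s ^+ 2 / 2) * sin (t * (a * s ^+ 2)) * phi) 0
  = t * s ^+ 2 * phi.
  rewrite derive_val /GRing.scale/=.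
  by rewrite !(mulr0, mul0r, expr0n, sin0, cos0, expR0)/=; ring.
by [].
Qed.

Lemma is_derive_normal_prob_cos t :
  is_derive t 1 (fun t => \int[N]_x cos (t * x)) (- \int[N]_x (x * sin (t * x))).
Proof.
pose f a x : R := cos (a * x).
have fD (a y : R) : is_derive a 1 (f ^~ y) (- (y * sin (a * y))).
  by rewrite /f; apply: is_derive_eq; rewrite /GRing.scale/=; ring.
have d1E (a y : R) : partial1of2 f a y = - (y * sin (a * y)).
  by rewrite partial1of2E derive_val.
have I0 : `]t - 1, t + 1[%classic t by rewrite /= in_itv/=; apply/andP; split; lra.
have bnd (a y : R) : `|- (y * sin (a * y))| <= G y.
  rewrite normrN normrM; have := @norm_mulr_expR_le 0 y.
  rewrite normr0 mul0r expR0 mulr1 => /(_ ler01); apply: le_trans.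
  by rewrite ler_piMr.
have H1 : forall x, `]t - 1, t + 1[%classic x -> N.-integrable setT (EFin \o f x).
  by move=> a _; exact: (@normal_prob_integrable_bounded (f a) 1 (mcos a) (fun x => cos_norm_le1 (a * x))).
have H2 : forall x y, `]t - 1, t + 1[%classic x -> setT y -> derivable (f ^~ y) x 1.
  by move=> x y _ _; have [] := fD x y.
have H3 : forall x y, `]t - 1, t + 1[%classic x -> setT y -> `|partial1of2 f x y| <= G y.
  by move=> x y _ _; rewrite d1E.
have D := @derivable_under_integral R _ _ N f setT measurableT t _ _ I0 H1 H2 G G_ge0 intG H3.
have E := @differentiation_under_integral R _ _ N f setT measurableT t _ _ I0 H1 H2 G G_ge0 intG H3.
apply: DeriveDef => //; rewrite -derive1E E.
have int : N.-integrable setT (EFin \o (fun x => x * sin (t * x))).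
  apply: intG_le; first exact: measurable_funM.
  by move=> x; rewrite -normrN.
rewrite -mulN1r -RintegralZl//.
by apply: eq_Rintegral => x _; rewrite d1E mulN1r.
Qed.

(** By Stein's identity the transform [phi] has derivative [- (t * s ^+ 2 * phi t)], so its product
    with [expR (t ^+ 2 * s ^+ 2 / 2)] is constant, and [phi 0 = 1]. *)
Lemma normal_prob_cos t : \int[N]_x cos (t * x) = expR (- (t ^+ 2 * s ^+ 2 / 2)).
Proof.
pose phi t := \int[N]_x cos (t * x).
have D (u : R) : is_derive u 1 (fun u => phi u * expR (u ^+ 2 * s ^+ 2 / 2)) 0.
  have Dp : is_derive u 1 phi (- (u * s ^+ 2 * phi u)).
    by rewrite -normal_prob_stein_sin; exact: is_derive_normal_prob_cos.
  by apply: is_derive_eq; rewrite /GRing.scale/=; field.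
have := is_derive_0_is_cst t 0 D.
rewrite expr0n/= !mul0r expR0 mulr1 => E.
have phi0 : phi 0 = 1.
  rewrite /phi; under eq_Rintegral do rewrite mul0r cos0.
  by rewrite Rintegral_cst//= N1 mulr1.
rewrite -/(phi t) expRN -[LHS](mulfK (lt0r_neq0 (expR_gt0 (t ^+ 2 * s ^+ 2 / 2)))) E phi0.
by rewrite mul1r.
Qed.

End normal_characteristic_function.

(** * Posterior mean *)

Section prior_iterated_integral.
Variables (R : realType) (K : nat) (gamma : 'cV[R]_K).
Hypothesis gamma_gt0 : forall k, 0 < gamma k ord0.
Implicit Types (b : 'I_K -> R) (s : seq 'I_K) (g : ('I_K -> R) -> \bar R).

Notation N k := (normal_prob 0 (Num.sqrt (gamma k ord0))).
Notation upd b k t := (fun j => if j == k then t else b j).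

Let sg0 k : Num.sqrt (gamma k ord0) != 0.
Proof. by rewrite sqrtr_eq0 -ltNge. Qed.

(* Measurability of a function of an environment [b], phrased through all
   measurable parametrisations so as to avoid a sigma-algebra on ['I_K -> R]. *)
Definition env_measurable g : Prop :=
  forall d (T : measurableType d) (e : T -> 'I_K -> R),
    (forall k, measurable_fun setT (fun t => e t k)) ->
    measurable_fun setT (fun t => g (e t)).

Lemma measurable_upd d (T : measurableType d) (e : T -> 'I_K -> R) k :
  (forall j, measurable_fun setT (fun t => e t j)) ->
  forall j, measurable_fun setT
    (fun z : T * measurableTypeR R => (upd (e z.1) k z.2) j).
Proof.
move=> me j /=; case: (j == k).
  exact: (@measurable_snd _ _ T (measurableTypeR R)).
by apply: (measurableT_comp (me j)); exact: measurable_fst.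
Qed.

Lemma env_measurable_prior_iint s g :
  env_measurable g -> env_measurable (prior_iint gamma s g).
Proof.
move=> mg; elim: s => [//|k s IH] d T e me /=.
pose F (z : T * measurableTypeR R) := prior_iint gamma s g (upd (e z.1) k z.2).
have mF : measurable_fun setT F by apply: IH; exact: measurable_upd.
(* Tonelli's measurability of partial integrals concerns nonnegative functions, while [g] may change
   sign; hence the two parts. *)
rewrite (_ : (fun t => _) =
    (fun t => fubini_F (N k) F^\+ t - fubini_F (N k) F^\- t)%E); last first.
  apply/funext => t; rewrite integralE; congr (_ - _)%E.
  - by rewrite /fubini_F; apply: eq_integral => x _; rewrite !funeposE.
  - by rewrite /fubini_F; apply: eq_integral => x _; rewrite !funenegE.
apply: emeasurable_funB.
- by apply: measurable_fun_fubini_tonelli_F => //; exact: measurable_funepos.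
- by apply: measurable_fun_fubini_tonelli_F => //; exact: measurable_funeneg.
Qed.

Lemma env_measurable_upd g b k : env_measurable g ->
  measurable_fun setT (fun t : measurableTypeR R => g (upd b k t)).
Proof. by move=> mg; apply: mg => j; case: (j == k). Qed.

Lemma prior_iint_ge0 s g b : (forall b, 0 <= g b)%E ->
  (0 <= prior_iint gamma s g b)%E.
Proof.
by move=> g0; elim: s b => //= k s IH b; apply: integral_ge0 => t _; exact: IH.
Qed.

(** When [s] enumerates all coordinates the starting environment is irrelevant and may be replaced
    by its reflection. *)
Lemma prior_iint_agree s g b b' : (forall j, j \notin s -> b j = b' j) ->
  prior_iint gamma s g b = prior_iint gamma s g b'.
Proof.
elim: s b b' => [|k s IH] b b' bb' /=.
  by congr g; apply/funext => j; exact: bb'.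
apply: eq_integral => t _; apply: IH => j js; case: eqP => // /eqP jk.
by apply: bb'; rewrite inE negb_or jk.
Qed.

(** A class that is stable under integrating out a coordinate and contains [b k] times a bounded
    likelihood. It makes every inner integral finite without a notion of joint integrability on
    environments. *)
Definition linear_growth g : Prop :=
  exists C, forall b, (`|g b| <= (C * (1 + \sum_j `|b j|))%:E)%E.

Let norm_integrable k : (N k).-integrable setT (fun t => `|t|%:E).
Proof.
have := integrable_abse (normal_prob_integrable_id (sg0 k)).
by apply: eq_integrable.
Qed.

Let linear_growth_upd b k t (C : R) : 0 <= C ->
  C * (1 + \sum_j `|upd b k t j|) <= C * (1 + \sum_j `|b j|) + C * `|t|.
Proof.
move=> C0; rewrite -mulrDr ler_wpM2l// -addrA lerD2l.
rewrite (bigD1 k)//= eqxx addrC lerD2r [leRHS](bigD1 k)//=.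
rewrite (eq_bigr (fun j => `|b j|)); first by rewrite lerDr.
by move=> j /negbTE ->.
Qed.

Let growth_pos g C : (forall b, `|g b| <= (C * (1 + \sum_j `|b j|))%:E)%E -> 0 <= C.
Proof.
move=> /(_ (fun=> 0)); under eq_bigr do rewrite normr0.
by rewrite big1_eq addr0 mulr1 => /(le_trans (abse_ge0 _)); rewrite lee_fin.
Qed.

Let affine_integrable b k (C : R) : (N k).-integrable setT
  (fun t => ((C * (1 + \sum_j `|b j|))%:E + C%:E * `|t|%:E)%E).
Proof.
apply: integrableD => //; first exact: finite_measure_integrable_cst.
exact: (integrableZl measurableT C (norm_integrable k)).
Qed.

Lemma linear_growth_integrable g b k : env_measurable g -> linear_growth g ->
  (N k).-integrable setT (fun t => g (upd b k t)).
Proof.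
move=> mg [C gC]; have C0 := growth_pos gC.
apply: (le_integrable measurableT _ _ (affine_integrable b k C)).
- exact: env_measurable_upd.
- move=> t _; apply: le_trans (gC _) _.
  rewrite -EFinM -EFinD gee0_abs ?lee_fin; first exact: linear_growth_upd.
  by rewrite addr_ge0// mulr_ge0// addr_ge0// sumr_ge0.
Qed.

Lemma linear_growth_prior_iint s g : env_measurable g -> linear_growth g ->
  linear_growth (prior_iint gamma s g).
Proof.
move=> mg lg; elim: s => [//|k s IH].
have [C gC] := IH; have C0 := growth_pos gC.
pose A := \int[N k]_t `|t|.
have A0 : 0 <= A by exact: Rintegral_ge0.
exists (C * (1 + A)) => b /=.
have mI := env_measurable_prior_iint s mg.
apply: le_trans (le_abse_integral _ measurableT _) _.
  exact: env_measurable_upd.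
apply: (@le_trans _ _ (\int[N k]_t ((C * (1 + \sum_j `|b j|))%:E + C%:E * `|t|%:E))%E).
  apply: ge0_le_integral => //.
  - by apply: measurableT_comp => //; exact: env_measurable_upd.
  - exact: measurable_int (affine_integrable b k C).
  - move=> t _; apply: le_trans (gC _) _.
    by rewrite -EFinM -EFinD lee_fin; exact: linear_growth_upd.
rewrite integralD//; last 2 first.
- exact: finite_measure_integrable_cst.
- exact: (integrableZl measurableT C (norm_integrable k)).
have N1 : N k setT = 1%E by exact: probability_setT.
rewrite (integralZl measurableT (norm_integrable k)).
rewrite (integral_cst _ measurableT (C * (1 + \sum_j `|b j|))%:E)/= N1 mule1.
have -> : (\int[N k]_t `|t|%:E)%E = A%:E.
  by rewrite /A /Rintegral fineK//; exact: (integrable_fin_num measurableT (norm_integrable k)).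
rewrite -EFinM -EFinD lee_fin.
have S0 : 0 <= \sum_j `|b j| by exact: sumr_ge0.
have : 0 <= C * A * \sum_j `|b j| by rewrite !mulr_ge0.
by set S := \sum_j _ => H; rewrite -subr_ge0 (_ : _ - _ = C * A * S)//; ring.
Qed.

Lemma prior_iint_fin_num s g b : env_measurable g -> linear_growth g ->
  prior_iint gamma s g b \is a fin_num.
Proof.
move=> mg lg; have [C /(_ b) H] := linear_growth_prior_iint s mg lg.
by rewrite -abse_fin_num fin_num_abs (le_lt_trans _ (ltry (C * (1 + \sum_j `|b j|))))// abse_id.
Qed.

Lemma prior_iint_linear s (a : R) g h b :
  env_measurable g -> linear_growth g -> env_measurable h -> linear_growth h ->
  prior_iint gamma s (fun b => g b + a%:E * h b)%E b =
  (prior_iint gamma s g b + a%:E * prior_iint gamma s h b)%E.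
Proof.
move=> mg lg mh lh; elim: s b => [//|k s IH] b /=.
under eq_integral do rewrite IH.
have ig := linear_growth_integrable b k (env_measurable_prior_iint s mg)
  (linear_growth_prior_iint s mg lg).
have ih := linear_growth_integrable b k (env_measurable_prior_iint s mh)
  (linear_growth_prior_iint s mh lh).
by rewrite integralD// ?integralZl//; exact: integrableZl.
Qed.

(** Makes the normalising constant of the posterior nonzero. If an integral were 0, the positive
    integrand would vanish almost everywhere, and the whole line would be null for a probability. *)
Lemma prior_iint_gt0 s g b : env_measurable g -> (forall b, 0 < g b)%E ->
  (0 < prior_iint gamma s g b)%E.
Proof.
move=> mg g0; elim: s b => [//|k s IH] b /=.
rewrite lt0e; apply/andP; split; last by apply: integral_ge0 => t _; exact: ltW.
apply/eqP => I0.
have mI := env_measurable_upd b k (env_measurable_prior_iint s mg).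
have := ae_eq_integral_abs (N k) measurableT mI.
under eq_integral do rewrite gee0_abs ?(ltW (IH _))//.
case=> /(_ I0) [A [mA NA0 sA]] _.
have : (N k setT <= N k A)%E.
  by apply: le_measure; rewrite ?inE// => t _; apply: sA => /= /(_ I) /eqP; rewrite gt_eqF.
by rewrite NA0 (_ : N k setT = 1%E) ?lee_fin ?ler10//; exact: probability_setT.
Qed.

Lemma ge0_prior_iintZ s k (h : R -> R) g b : k \notin s ->
  (forall x, 0 <= h x) -> env_measurable g -> (forall b, 0 <= g b)%E ->
  prior_iint gamma s (fun b => (h (b k))%:E * g b)%E b =
  ((h (b k))%:E * prior_iint gamma s g b)%E.
Proof.
move=> + h0 mg g0; elim: s b => [//|j s IH] b /=.
rewrite inE negb_or => /andP[kj ks]; under eq_integral do rewrite IH// (negbTE kj).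
rewrite ge0_integralZl//.
- exact: env_measurable_upd (env_measurable_prior_iint s mg).
- by move=> t _; exact: prior_iint_ge0.
- by rewrite lee_fin.
Qed.

Definition reflect_env (m b : 'I_K -> R) := fun j => 2 * m j - b j.

(* Ratio of the prior densities of the [k]th coordinate at [2 m_k - x] and [x]. *)
Definition reflect_ratio (m : 'I_K -> R) k (x : R) :=
  expR ((x ^+ 2 - (2 * m k - x) ^+ 2) / (Num.sqrt (gamma k ord0) ^+ 2 *+ 2)).

Lemma measurable_reflect_ratio m k : measurable_fun setT (reflect_ratio m k).
Proof.
apply: measurableT_comp => //; apply: measurable_funM => //.
by apply: measurable_funB; apply: measurable_funX => //; exact: measurable_funB.
Qed.

Lemma env_measurable_reflect m s g : env_measurable g ->
  env_measurable (fun b => (\prod_(j <- s) reflect_ratio m j (b j))%:E *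
                           g (reflect_env m b))%E.
Proof.
move=> mg d T e me; apply: emeasurable_funM.
  apply/measurable_EFinP; apply: measurable_prod => j _.
  by apply: (measurableT_comp _ (me j)); exact: measurable_reflect_ratio.
by apply: mg => j; exact: measurable_funB.
Qed.

(** One-dimensional changes of variable, coordinate by coordinate. It is stated for nonnegative [g]
    because the ratios may grow exponentially, outside the class [linear_growth]. *)
Lemma prior_iint_reflect m s g b : uniq s -> env_measurable g ->
  (forall b, 0 <= g b)%E ->
  prior_iint gamma s g (reflect_env m b) =
  prior_iint gamma s (fun b => (\prod_(j <- s) reflect_ratio m j (b j))%:E *
                           g (reflect_env m b))%E b.
Proof.
move=> + mg g0; elim: s b => [|k s IH] b /=; first by rewrite big_nil mul1e.
move=> /andP[ks us].
have mphi : measurable_fun [set: R] (fun x : R => 2 * m k - x) by exact: measurable_funB.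
rewrite (ge0_integral_normal_prob_change (sg0 k) mphi (@lebesgue_measure_reflect R _)); last 2 first.
- exact: env_measurable_upd (env_measurable_prior_iint s mg).
- by move=> t; exact: prior_iint_ge0.
apply: eq_integral => t _ /=.
have -> : (fun j => if j == k then 2 * m k - t else reflect_env m b j) =
    reflect_env m (upd b k t).
  by apply/funext => j; rewrite /reflect_env; case: eqP => // ->.
(* The ratio for [k] is constant along the remaining integrations because [k] is not in [s], so it
   can be moved inside them. *)
have E := @ge0_prior_iintZ s k (reflect_ratio m k)
  (fun b => (\prod_(j <- s) reflect_ratio m j (b j))%:E * g (reflect_env m b))%E
  (upd b k t) ks.
rewrite /= eqxx in E.
rewrite IH// muleC -/(reflect_ratio m k t) -E.
- by congr prior_iint; apply/funext => c; rewrite big_cons muleA -EFinM.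
- by move=> x; exact: expR_ge0.
- exact: env_measurable_reflect.
- move=> c; rewrite mule_ge0// lee_fin prodr_ge0// => j _; exact: expR_ge0.
Qed.

End prior_iterated_integral.

Section posterior_mean.
Variables (R : realType) (n K : nat) (X : 'M[R]_(n, K)) (v : R).
Variables (gamma : 'cV[R]_K) (y : 'cV[R]_n).
Hypothesis v_gt0 : 0 < v.
Hypothesis gamma_gt0 : forall k, 0 < gamma k ord0.

Let lik (b : 'I_K -> R) := likelihood X v y (\col_k b k).

Let sv0 : Num.sqrt v != 0. Proof. by rewrite sqrtr_eq0 -ltNge. Qed.

Let likE b : lik b = normal_peak (Num.sqrt v) ^+ n *
  expR (- (\sum_(i < n) (y i 0 - \sum_j X i j * b j) ^+ 2) / (v *+ 2)).
Proof.
rewrite /lik /likelihood.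
under eq_bigr do rewrite normal_pdfE//.
rewrite big_split/= prodr_const card_ord; congr (_ * _).
rewrite /normal_fun -expR_sum; congr expR.
rewrite sqr_sqrtr ?ltW// -mulr_suml sumrN; congr (- _ / _).
by apply: eq_bigr => i _; rewrite !mxE; congr ((_ - _) ^+ 2); apply: eq_bigr => j _; rewrite mxE.
Qed.

Let lik_gt0 b : 0 < lik b.
Proof. by rewrite likE mulr_gt0 ?expR_gt0// exprn_gt0// normal_peak_gt0. Qed.

Let lik_le b : lik b <= normal_peak (Num.sqrt v) ^+ n.
Proof.
rewrite likE ler_piMr ?exprn_ge0 ?normal_peak_ge0//.
rewrite -[leRHS]expR0 ler_expR mulNr oppr_le0 divr_ge0//.
  by apply: sumr_ge0 => i _; exact: sqr_ge0.
by rewrite mulrn_wge0// ltW.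
Qed.

Let measurable_lik d (T : measurableType d) (e : T -> 'I_K -> R) :
  (forall k, measurable_fun setT (fun t => e t k)) ->
  measurable_fun setT (fun t => lik (e t)).
Proof.
move=> me; under eq_fun do rewrite likE.
apply: measurable_funM => //; apply: measurableT_comp => //.
apply: measurable_funM => //; apply: measurable_funN.
apply: measurable_sum => i; apply: measurable_funX; apply: measurable_funB => //.
by apply: measurable_sum => j; exact: measurable_funM.
Qed.

Let growth (h : ('I_K -> R) -> R) (C : R) k :
  (forall b, `|h b| <= C * (1 + `|b k|)) -> 0 <= C ->
  linear_growth (fun b => (h b)%:E).
Proof.
move=> hC C0; exists C => b; rewrite abse_EFin lee_fin; apply: le_trans (hC b) _.
by rewrite ler_wpM2l// lerD2l (bigD1 k)//= lerDl sumr_ge0.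
Qed.

Variable m : 'I_K -> R.
Hypothesis normal_equation : forall j, m j / gamma j ord0 =
  (\sum_i X i j * (y i 0 - \sum_l X i l * m l)) / v.

(* The joint density of [(y, beta)] is symmetric in [beta] about [m]. *)
Lemma likelihood_reflect b :
  \prod_(j <- enum 'I_K) reflect_ratio gamma m j (b j) * lik (reflect_env m b) = lik b.
Proof.
rewrite !likE mulrCA; congr (_ * _).
rewrite big_enum/= /reflect_ratio -expR_sum -expRD; congr expR.
apply/eqP; rewrite -subr_eq0; apply/eqP.
pose w i := y i 0 - \sum_l X i l * m l.
(* The residuals at [b] and at its reflection are [w - X (b - m)] and [w + X (b - m)]; their squares
   differ by the cross term only. *)
have E1 : \sum_(i < n) (y i 0 - \sum_j X i j * reflect_env m b j) ^+ 2 =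
    \sum_(i < n) (y i 0 - \sum_j X i j * b j) ^+ 2 +
    4 * \sum_j (b j - m j) * \sum_i X i j * w i.
  rewrite [X in 4 * X](_ : _ = \sum_i (\sum_j X i j * (b j - m j)) * w i); last first.
    under eq_bigr do rewrite mulr_sumr.
    rewrite exchange_big/=; apply: eq_bigr => i _; rewrite mulr_suml.
    by apply: eq_bigr => j _; ring.
  rewrite mulr_sumr -big_split/=; apply: eq_bigr => i _.
  have -> : \sum_j X i j * (b j - m j) = \sum_j X i j * b j - \sum_j X i j * m j.
    by rewrite -sumrB; apply: eq_bigr => j _; ring.
  have -> : \sum_j X i j * reflect_env m b j = 2 * (\sum_j X i j * m j) - \sum_j X i j * b j.
    by rewrite mulr_sumr -sumrB; apply: eq_bigr => j _; rewrite /reflect_env; ring.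
  by rewrite /w; ring.
(* Here [b^2 - (2 m - b)^2 = 4 m (b - m)], and [normal_equation] trades [m / gamma] for the inner
   products of [E1], so the two changes of exponent cancel. *)
have E2 : \sum_(j < K) (b j ^+ 2 - (2 * m j - b j) ^+ 2) / (Num.sqrt (gamma j ord0) ^+ 2 *+ 2)
   = 2 * (\sum_j (b j - m j) * \sum_i X i j * w i) / v.
  rewrite -mulrA mulr_suml mulr_sumr; apply: eq_bigr => j _.
  have := normal_equation j; rewrite -/(w _) => H.
  have g0 : gamma j ord0 != 0 by rewrite gt_eqF.
  rewrite sqr_sqrtr ?ltW// -mulrA -H.
  by field.
rewrite E1 E2; have v0 : v != 0 by rewrite gt_eqF.
by field.
Qed.

Lemma posterior_mean_normal_equation : posterior_mean X v gamma y = \col_k m k.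
Proof.
apply/matrixP => k z; rewrite !mxE {z}.
pose C := normal_peak (Num.sqrt v) ^+ n.
have C0 : 0 <= C by rewrite exprn_ge0// normal_peak_ge0.
(* The reflection swaps these positive and negative parts of [b k - m k], so their integrals are
   equal; the splitting also supplies the nonnegative integrands that [prior_iint_reflect] takes. *)
pose hp b := Num.max (b k - m k) 0 * lik b.
pose hm b := Num.max (m k - b k) 0 * lik b.
pose EF (h : ('I_K -> R) -> R) := fun b => (h b)%:E.
have mL : env_measurable (EF lik).
  by move=> d T e me; apply/measurable_EFinP; exact: measurable_lik.
have mP : env_measurable (EF hp).
  move=> d T e me; apply/measurable_EFinP; apply: measurable_funM; last exact: measurable_lik.
  by apply: measurable_maxr => //; exact: measurable_funB.
have mM : env_measurable (EF hm).
  move=> d T e me; apply/measurable_EFinP; apply: measurable_funM; last exact: measurable_lik.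
  by apply: measurable_maxr => //; exact: measurable_funB.
have lL : linear_growth (EF lik).
  apply: (@growth _ C k) => // b; rewrite (ger0_norm (ltW (lik_gt0 b))).
  by apply: le_trans (lik_le b) _; rewrite ler_peMr// lerDl.
have lmax (b : 'I_K -> R) (u : R) : `|u| <= `|m k| + `|b k| ->
    `|Num.max u 0 * lik b| <= C * (1 + `|m k|) * (1 + `|b k|).
  move=> ub; rewrite normrM (ger0_norm (ltW (lik_gt0 b))) mulrC -mulrA.
  apply: ler_pM => //; first exact: ltW.
  apply: (@le_trans _ _ `|u|).
    by rewrite ger0_norm ?le_max ?lexx ?orbT// ge_max ler_norm normr_ge0.
  apply: le_trans ub _; rewrite mulrDl mul1r mulrDr mulr1.
  have : 0 <= `|m k| * `|b k| by rewrite mulr_ge0.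
  by move: `|m k| `|b k| => p q *; lra.
have C1 : 0 <= C * (1 + `|m k|) by rewrite mulr_ge0// addr_ge0.
have lP : linear_growth (EF hp).
  apply: (growth _ C1) => b; apply: lmax; rewrite [leRHS]addrC; exact: ler_normB.
have lM : linear_growth (EF hm).
  by apply: (growth _ C1) => b; apply: lmax; exact: ler_normB.
have split_beta : (fun b => (b k * lik b)%:E) =
    (fun b => (EF hp b + (-1)%:E * EF hm b) + (m k)%:E * EF lik b)%E.
  apply/funext => b; rewrite /EF -!EFinM -!EFinD; congr EFin.
  rewrite /hp /hm; have [bm|bm] := leP (b k) (m k).
    rewrite max_r ?subr_le0// max_l ?subr_ge0//; ring.
  rewrite max_l ?subr_ge0 ?ltW// max_r ?subr_le0 ?ltW//; ring.
pose b0 : 'I_K -> R := fun=> 0.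
pose I g := prior_iint gamma (enum 'I_K) g b0.
have hpm : I (EF hp) = I (EF hm).
  rewrite /I (@prior_iint_agree _ _ _ _ _ _ (reflect_env m b0)); last first.
    by move=> j; rewrite mem_enum.
  rewrite prior_iint_reflect//; last 2 first.
  - exact: enum_uniq.
  - by move=> b; rewrite lee_fin (mulr_ge0 _ (ltW (lik_gt0 b)))// le_max lexx orbT.
  congr prior_iint; apply/funext => b; rewrite /EF -EFinM; congr EFin.
  rewrite /hp /hm mulrCA likelihood_reflect /reflect_env.
  by congr (Num.max _ _ * _); ring.
have fP := prior_iint_fin_num gamma_gt0 (enum 'I_K) b0 mP lP.
have fM := prior_iint_fin_num gamma_gt0 (enum 'I_K) b0 mM lM.
have fL := prior_iint_fin_num gamma_gt0 (enum 'I_K) b0 mL lL.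
have mD : env_measurable (fun b => EF hp b + (-1)%:E * EF hm b)%E.
  move=> d T e me; apply: emeasurable_funD; first exact: mP.
  by apply: emeasurable_funM => //; exact: mM.
have lD : linear_growth (fun b => EF hp b + (-1)%:E * EF hm b)%E.
  have [C2 H2] := lP; have [C3 H3] := lM; exists (C2 + C3) => b.
  rewrite mulrDl EFinD; apply: le_trans (lee_abs_add _ _) _.
  by apply: leeD => //; rewrite abseM abse_EFin normrN1 mul1e.
have num : prior_expect gamma (fun beta => beta k 0 * likelihood X v y beta) =
    (m k * fine (I (EF lik)))%:E.
  rewrite /prior_expect [X in prior_iint _ _ X](_ : _ = (fun b => (b k * lik b)%:E)); last first.
    by apply/funext => b; rewrite /lik mxE.
  rewrite split_beta !prior_iint_linear// -/(I _) -/(I (EF hm)) -/(I (EF lik)) hpm.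
  by rewrite EFinM fineK// mulN1e subee// add0e.
rewrite num /= /prior_expect -/(I (EF lik)) mulfK//.
have := prior_iint_gt0 gamma (enum 'I_K) b0 mL (fun b => lik_gt0 b).
by move=> gL; rewrite gt_eqF// fine_gt0// gL ltey_eq fL.
Qed.

End posterior_mean.

(** * Sums of independent errors *)

Section independent_pair.
Context d (T : measurableType d) (R : realType) (P : probability T R).
Variables (U V : T -> R).
Hypotheses (mU : measurable_fun setT U) (mV : measurable_fun setT V).
Hypothesis UV : forall B C, measurable B -> measurable C ->
  P ((U @^-1` B) `&` (V @^-1` C)) = (P (U @^-1` B) * P (V @^-1` C))%E.

Let W := fun w => (U w, V w).
Let mW : measurable_fun setT W. Proof. exact: measurable_fun_pair. Qed.

HB.instance Definition _ := isMeasurableFun.Build _ _ _ _ U mU.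
HB.instance Definition _ := isMeasurableFun.Build _ _ _ _ V mV.
HB.instance Definition _ := isMeasurableFun.Build _ _ _ _ W mW.

Let joint_law A : measurable A ->
  (distribution P U \x distribution P V)%E A = distribution P W A.
Proof. by apply: product_measure_unique => B C mB mC; exact: UV. Qed.

(** The law of the pair is the product of the laws, since they agree on rectangles; the
    factorisation is then Tonelli's theorem. *)
Lemma ge0_independent_integral (F G : R -> \bar R) :
  measurable_fun setT F -> measurable_fun setT G ->
  (forall x, 0 <= F x)%E -> (forall x, 0 <= G x)%E ->
  (\int[P]_w (F (U w) * G (V w)) = \int[P]_w F (U w) * \int[P]_w G (V w))%E.
Proof.
move=> mF mG F0 G0.
have mFG : measurable_fun setT (fun z : R * R => (F z.1 * G z.2)%E).
  by apply: emeasurable_funM; apply: measurableT_comp.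
have FG0 z : (0 <= (fun z : R * R => F z.1 * G z.2) z)%E by rewrite mule_ge0.
have -> : (\int[P]_w (F (U w) * G (V w)) =
    \int[distribution P W]_z (F z.1 * G z.2))%E.
  by rewrite ge0_integral_distribution.
transitivity (\int[distribution P U \x distribution P V]_z (F z.1 * G z.2))%E.
  by apply: eq_measure_integral => A mA _; apply/esym; exact: joint_law.
rewrite fubini_tonelli1//= /fubini_F/=.
under eq_integral do rewrite ge0_integralZl//.
rewrite ge0_integralZr//; last exact: integral_ge0.
by rewrite !ge0_integral_distribution.
Qed.

Lemma independent_integrable (F G : R -> R) :
  measurable_fun setT F -> measurable_fun setT G ->
  P.-integrable setT (fun w => (F (U w))%:E) ->
  P.-integrable setT (fun w => (G (V w))%:E) ->
  P.-integrable setT (fun w => (F (U w) * G (V w))%:E).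
Proof.
move=> mF mG /integrableP[_ iF] /integrableP[_ iG]; apply/integrableP; split.
  by apply/measurable_EFinP; apply: measurable_funM; exact: measurableT_comp.
under eq_integral do rewrite EFinM abseM.
rewrite (@ge0_independent_integral (fun x => `|(F x)%:E|%E) (fun x => `|(G x)%:E|%E))//.
- by rewrite lte_mul_pinfty ?ge0_fin_numE// integral_ge0.
- by apply: measurableT_comp => //; exact/measurable_EFinP.
- by apply: measurableT_comp => //; exact/measurable_EFinP.
Qed.

Lemma independent_Rintegral (F G : R -> R) :
  measurable_fun setT F -> measurable_fun setT G ->
  P.-integrable setT (fun w => (F (U w))%:E) ->
  P.-integrable setT (fun w => (G (V w))%:E) ->
  \int[P]_w (F (U w) * G (V w)) = \int[P]_w F (U w) * \int[P]_w G (V w).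
Proof.
move=> mF mG iF iG; have iFG := independent_integrable mF mG iF iG.
have mFE : measurable_fun setT (EFin \o F) by exact/measurable_EFinP.
have mGE : measurable_fun setT (EFin \o G) by exact/measurable_EFinP.
have mFG : measurable_fun setT (fun z : R * R => (F z.1 * G z.2)%:E).
  by apply/measurable_EFinP; apply: measurable_funM; apply: measurableT_comp.
have iW : (distribution P W).-integrable setT (fun z : R * R => (F z.1 * G z.2)%:E).
  by apply: integrable_pushforward.
have iUV : (distribution P U \x distribution P V)%E.-integrable setT (fun z : R * R => (F z.1 * G z.2)%:E).
  move/integrableP: iW => [_ iW]; apply/integrableP; split => //.
  move: iW; congr (_ < _)%E; apply: eq_measure_integral => A mA _.
  by apply/esym; exact: joint_law.
have iU : (distribution P U).-integrable setT (EFin \o F) by exact: integrable_pushforward.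
have iV : (distribution P V).-integrable setT (EFin \o G) by exact: integrable_pushforward.
have -> : \int[P]_w (F (U w) * G (V w)) =
    \int[(distribution P U \x distribution P V)%E]_z (F z.1 * G z.2).
  rewrite /Rintegral; congr fine.
  transitivity (\int[distribution P W]_z (F z.1 * G z.2)%:E)%E.
    by rewrite integral_distribution.
  by apply: eq_measure_integral => A mA _; apply/esym; exact: joint_law.
rewrite /Rintegral -(integral12_prod_meas1 iUV) /fubini_F /=.
under eq_integral do (under eq_integral do rewrite EFinM).
under eq_integral do rewrite integralZl//.
have fV : (\int[distribution P V]_y (G y)%:E)%E \is a fin_num by exact: (integrable_fin_num measurableT iV).
under eq_integral do rewrite -(fineK fV).
rewrite integralZr// fineM//; last exact: (integrable_fin_num measurableT iU).
by rewrite -(integral_distribution (f := EFin \o F))// -(integral_distribution (f := EFin \o G)).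
Qed.

End independent_pair.

Section independent_partial_sums.
Context d (T : measurableType d) (R : realType) (P : probability T R).
Variables (n : nat) (eps : 'I_n -> T -> R).
Hypothesis meps : forall i, measurable_fun setT (eps i).
Hypothesis ieps : mutually_independent P eps.

Let cyl (B : 'I_n -> set R) := \bigcap_(i in [set: 'I_n]) (eps i @^-1` B i).

(** Events that constrain only the errors of index below [j]. They form a pi-system, and the
    sigma-algebra it generates makes [partial_sum a j] measurable. *)
Let past (j : 'I_n) : set (set T) := [set A | exists B : 'I_n -> set R,
  [/\ forall i, measurable (B i), forall i : 'I_n, (j <= i)%N -> B i = setT & A = cyl B]].

Let meas_eps i (B : set R) : measurable B -> measurable (eps i @^-1` B).
Proof. by move=> mB; rewrite -[X in measurable X]setTI; exact: meps. Qed.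

Let meas_cyl B : (forall i, measurable (B i)) -> measurable (cyl B).
Proof.
move=> mB; apply: fin_bigcap_measurable => //.
by move=> i _; exact: meas_eps.
Qed.

Let past_setI j : setI_closed (past j).
Proof.
move=> _ _ [B [mB tB ->]] [C [mC tC ->]].
exists (fun i => B i `&` C i); split.
- by move=> i; exact: measurableI.
- by move=> i ji; rewrite tB// tC// setIT.
- rewrite /cyl; apply/seteqP; split => w.
    by move=> [wB wC] i _; split; [exact: wB|exact: wC].
  by move=> wBC; split => i _; case: (wBC i I).
Qed.

Let past_indep j A (C : set R) : past j A -> measurable C ->
  P (A `&` eps j @^-1` C) = (P A * P (eps j @^-1` C))%E.
Proof.
move=> [B [mB tB ->]] mC.
(* Slot [j] of [B] is [setT], hence free to hold [C]; the product rules for [B'] and for [B] then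
   differ by one factor. *)
pose B' i := if i == j then C else B i.
have mB' i : measurable (B' i) by rewrite /B'; case: ifP.
have -> : cyl B `&` eps j @^-1` C = cyl B'.
  apply/seteqP; split => w.
    by move=> [wB wC] i _; rewrite /B' /preimage/=; case: eqP => [->//|_]; exact: wB.
  move=> wB'; split; last by have := wB' j I; rewrite /B' /preimage/= eqxx.
  move=> i _; have := wB' i I; rewrite /B' /preimage/=; case: eqP => // -> _.
  by rewrite tB.
rewrite /cyl !ieps// (bigD1 j)//= [in RHS](bigD1 j)//= /B' eqxx tB// preimage_setT probability_setT mul1e.
by rewrite muleC; congr (_ * _)%E; apply: eq_bigr => i /negbTE ->.
Qed.

(** As functions of [A] both sides are finite measures, a restriction of [P] and a multiple of [P].
    They agree on the pi-system [past j], hence on the sigma-algebra it generates. *)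
Let sigma_past_indep j A (C : set R) : <<s past j >> A -> measurable C ->
  P (A `&` eps j @^-1` C) = (P A * P (eps j @^-1` C))%E.
Proof.
move=> sA mC; have mD := meas_eps j mC.
have fD : P (eps j @^-1` C) \is a fin_num by exact: fin_num_measure.
have r0 : 0 <= fine (P (eps j @^-1` C)) by exact: fine_ge0.
pose m1 : {measure set T -> \bar R} := mrestr P mD.
pose m2 : {measure set T -> \bar R} := mscale (NngNum r0) P.
have past_meas : past j `<=` measurable by move=> _ [B [mB _ ->]]; exact: meas_cyl.
rewrite -[LHS]/(m1 A) (_ : (P A * _)%E = m2 A); last first.
  by rewrite /m2/= /mscale/= fineK// muleC.
apply: (@g_sigma_algebra_measure_unique _ R T (past j) past_meas (fun=> setT)) => //.
- move=> _; exists (fun=> setT); split => //.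
  by rewrite /cyl; apply/seteqP; split.
- by rewrite bigcup_const.
- move=> E pE; rewrite /m1/= /mrestr/= past_indep// /m2/= /mscale/=.
  by rewrite fineK// muleC.
- move=> _; rewrite /m1/= /mrestr/= setTI.
  by rewrite ltey_eq fD.
Qed.

Definition partial_sum (a : 'I_n -> R) (j : nat) (w : T) : R :=
  \sum_(i < n | (i < j)%N) a i * eps i w.

Lemma measurable_partial_sum a j : measurable_fun setT (partial_sum a j).
Proof.
rewrite /partial_sum; under eq_fun do rewrite big_mkcond/=.
by apply: measurable_sum => i; case: (boolP (i < j)%N) => // _; exact: measurable_funM.
Qed.

Lemma partial_sum_independent a (j : 'I_n) (B C : set R) :
  measurable B -> measurable C ->
  P ((partial_sum a j @^-1` B) `&` (eps j @^-1` C)) =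
  (P (partial_sum a j @^-1` B) * P (eps j @^-1` C))%E.
Proof.
move=> mB mC; apply: sigma_past_indep => //.
(* This is [T] with the smaller sigma-algebra: measurability of the partial sum on [T'] places the
   preimage of [B] in the scope of [sigma_past_indep]. *)
pose T' := g_sigma_algebraType (past j).
have me (i : 'I_n) : (i < j)%N -> measurable_fun [set: T'] (eps i : T' -> R).
  move=> ij _ Y mY; rewrite setTI; apply: sub_gen_smallest.
  exists (fun i' => if i' == i then Y else setT); split.
  - by move=> i'; case: ifP.
  - by move=> i' ji'; case: eqP => // E; move: ij; rewrite -E ltnNge ji'.
  - rewrite /cyl; apply/seteqP; split => w.
      by move=> wY i' _; rewrite /preimage/=; case: eqP => // ->.
    by move=> /(_ i I); rewrite /preimage/= eqxx.
have mS : measurable_fun [set: T'] (partial_sum a j : T' -> R).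
  rewrite /partial_sum; under eq_fun do rewrite big_mkcond/=.
  apply: measurable_sum => i; case: (boolP (i < j)%N) => // ij.
  by apply: measurable_funM => //; exact: me.
by have := mS measurableT B mB; rewrite setTI.
Qed.

Lemma partial_sumS a (j : 'I_n) w :
  partial_sum a j.+1 w = partial_sum a j w + a j * eps j w.
Proof.
rewrite /partial_sum (bigD1 j)//= addrC; congr (_ + _); apply: eq_bigl => i.
by rewrite ltnS ltn_neqAle andbC.
Qed.

Lemma partial_sum0 a w : partial_sum a 0 w = 0.
Proof. by rewrite /partial_sum big_pred0. Qed.

Lemma partial_sumT a w : partial_sum a n w = \sum_i a i * eps i w.
Proof. by apply: eq_bigl => i; rewrite ltn_ord. Qed.

End independent_partial_sums.

(** * Lindeberg comparison with the Gaussian cosine transform *)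

Section lindeberg.
Context d (T : measurableType d) (R : realType) (P : probability T R).
Variables (n : nat) (eps : 'I_n -> T -> R) (M : R).
Hypothesis meps : forall i, measurable_fun setT (eps i).
Hypothesis ieps : mutually_independent P eps.
Hypothesis eps1 : forall i, (\int[P]_w (eps i w)%:E = 0)%E.
Hypothesis eps2 : forall i, (\int[P]_w (eps i w ^+ 2)%:E = 1)%E.
Hypothesis eps4 : forall i, (\int[P]_w (eps i w ^+ 4)%:E <= M%:E)%E.
Implicit Types (i : 'I_n) (c t p q r : R).

Lemma integrable_norm_le (f g : T -> R) : measurable_fun setT f ->
  P.-integrable setT (EFin \o g) -> (forall w, `|f w| <= g w) ->
  P.-integrable setT (EFin \o f).
Proof.
move=> mf ig fg; apply: (le_integrable measurableT _ _ ig).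
  exact/measurable_EFinP.
by move=> w _; rewrite /= lee_fin; apply: le_trans (fg w) (ler_norm _).
Qed.

Lemma integrable_bounded (f : T -> R) (C : R) : measurable_fun setT f ->
  (forall w, `|f w| <= C) -> P.-integrable setT (EFin \o f).
Proof.
move=> mf fC; apply: (@integrable_norm_le f (fun=> C)) => //.
exact: finite_measure_integrable_cst.
Qed.

Let integrable_ge0 (f : T -> R) (r : R) : measurable_fun setT f ->
  (forall w, 0 <= f w) -> (\int[P]_w (f w)%:E <= r%:E)%E ->
  P.-integrable setT (EFin \o f).
Proof.
move=> mf f0 fr; apply/integrableP; split; first exact/measurable_EFinP.
under eq_integral do rewrite gee0_abs ?lee_fin//.
exact: le_lt_trans fr (ltry _).
Qed.

Let i2 i : P.-integrable setT (EFin \o (fun w => eps i w ^+ 2)).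
Proof.
apply: (@integrable_ge0 _ 1) => //; first exact: measurable_funX.
  by move=> w; exact: sqr_ge0.
by rewrite eps2.
Qed.

Let i4 i : P.-integrable setT (EFin \o (fun w => eps i w ^+ 4)).
Proof.
apply: (@integrable_ge0 _ M) => //; first exact: measurable_funX.
by move=> w; exact: exprn_even_ge0.
Qed.

Let icst r : P.-integrable setT (EFin \o (fun=> r)).
Proof. exact: finite_measure_integrable_cst. Qed.

Let iZ r (f : T -> R) : P.-integrable setT (EFin \o f) ->
  P.-integrable setT (EFin \o (fun w => r * f w)).
Proof.
move=> fi; rewrite /comp; under eq_fun do rewrite EFinM.
exact: integrableZl.
Qed.

Let iD (f g : T -> R) : P.-integrable setT (EFin \o f) ->
  P.-integrable setT (EFin \o g) ->
  P.-integrable setT (EFin \o (fun w => f w + g w)).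
Proof.
move=> fi gi; rewrite /comp; under eq_fun do rewrite EFinD.
exact: integrableD.
Qed.

Let i1 i : P.-integrable setT (EFin \o eps i).
Proof.
apply: (@integrable_norm_le _ (fun w => 1 + eps i w ^+ 2)) => //.
  exact: iD.
by move=> w; rewrite ler_norml; apply/andP; split; nra.
Qed.

Let m4 i := \int[P]_w eps i w ^+ 4.

Let m4_ge0 i : 0 <= m4 i.
Proof. by apply: Rintegral_ge0 => w _; exact: exprn_even_ge0. Qed.

Let m4_le i : m4 i <= M.
Proof.
rewrite -lee_fin /m4 /Rintegral fineK//.
exact: (integrable_fin_num measurableT (i4 i)).
Qed.

Let Rcst r : \int[P]_(w in setT) r = r.
Proof. by rewrite Rintegral_cst//= probability_setT mulr1. Qed.

Let integrable_quartic i p q r :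
  P.-integrable setT (EFin \o (fun w => p + q * eps i w ^+ 2 + r * eps i w ^+ 4)).
Proof. by apply: iD; [apply: iD => //|]; exact: iZ. Qed.

Let Rintegral_quartic i p q r :
  \int[P]_w (p + q * eps i w ^+ 2 + r * eps i w ^+ 4) = p + q + r * m4 i.
Proof.
rewrite RintegralD//; last 2 first.
- by apply: iD => //; exact: iZ.
- exact: iZ.
rewrite RintegralD//; last exact: iZ.
rewrite (RintegralZl _ measurableT (i2 i)) (RintegralZl _ measurableT (i4 i)) Rcst.
by rewrite [X in q * X]/Rintegral eps2 mulr1.
Qed.

Let mcos t c (f : T -> R) : measurable_fun setT f ->
  measurable_fun setT (fun w => cos (c + t * f w)).
Proof.
move=> mf; apply: measurable_cos_comp; apply: measurable_funD => //.
exact: measurable_funM.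
Qed.

Let msin t c (f : T -> R) : measurable_fun setT f ->
  measurable_fun setT (fun w => sin (c + t * f w)).
Proof.
move=> mf; apply: measurable_sin_comp; apply: measurable_funD => //.
exact: measurable_funM.
Qed.

Let cos_norm_le1 (x : R) : `|cos x| <= 1.
Proof. by rewrite ler_norml cos_geN1 cos_le1. Qed.

Let sin_norm_le1 (x : R) : `|sin x| <= 1.
Proof. by rewrite ler_norml sin_geN1 sin_le1. Qed.

Let icos t c (f : T -> R) : measurable_fun setT f ->
  P.-integrable setT (EFin \o (fun w => cos (c + t * f w))).
Proof. by move=> mf; apply: (@integrable_bounded _ 1) => //; exact: mcos. Qed.

Let isin t c (f : T -> R) : measurable_fun setT f ->
  P.-integrable setT (EFin \o (fun w => sin (c + t * f w))).
Proof. by move=> mf; apply: (@integrable_bounded _ 1) => //; exact: msin. Qed.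

(** The second moments match, so what remains is at most [M / 24] from the quartic Taylor term and
    [1 / 8] from the exponential, times [t ^+ 4]; [M + 3] absorbs both. *)
Let cos_eps i t :
  `|\int[P]_w cos (0 + t * eps i w) - expR (- (t ^+ 2 / 2))| <= (M + 3) * t ^+ 4.
Proof.
have t2 : 0 <= t ^+ 2 / 2 by rewrite divr_ge0// sqr_ge0.
have := expRN_sub_affine_le t2; set E := expR _ => HE.
have lo : 1 - t ^+ 2 / 2 <= \int[P]_w cos (0 + t * eps i w).
  rewrite [leLHS](_ : _ = 1 + (- (t ^+ 2 / 2)) + 0 * m4 i); last by ring.
  rewrite -Rintegral_quartic; apply: (le_Rintegral measurableT (integrable_quartic _ _ _ _) (icos _ _ (meps i))).
  move=> w _; rewrite add0r; apply: le_trans (cos_ge_quadratic _).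
  by rewrite exprMn le_eqVlt; apply/orP; left; apply/eqP; field.
have hi : \int[P]_w cos (0 + t * eps i w) <= 1 - t ^+ 2 / 2 + t ^+ 4 / 24 * m4 i.
  rewrite -Rintegral_quartic; apply: (le_Rintegral measurableT (icos _ _ (meps i)) (integrable_quartic _ _ _ _)).
  move=> w _; rewrite add0r; apply: le_trans (cos_le_quartic _) _.
  by rewrite !exprMn le_eqVlt; apply/orP; left; apply/eqP; field.
have t4 : 0 <= t ^+ 4 by exact: exprn_even_ge0.
have E4 : (t ^+ 2 / 2) ^+ 2 / 2 = t ^+ 4 / 8 by field.
rewrite E4 in HE; move: HE; rewrite !ler_norml => /andP[h1 h2].
have := m4_le i; have := m4_ge0 i.
by move=> *; apply/andP; split; nra.
Qed.

(** The errors are centred, so subtracting [t * eps i w] leaves the integral unchanged and reduces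
    the integrand to a cubic remainder. *)
Let sin_eps i t : `|\int[P]_w sin (0 + t * eps i w)| <= (M + 3) * `|t| ^+ 3.
Proof.
have -> : \int[P]_w sin (0 + t * eps i w) =
    \int[P]_w (sin (0 + t * eps i w) - t * eps i w).
  rewrite RintegralB//; last 2 first.
  - exact: isin.
  - exact/iZ/i1.
  by rewrite RintegralZl// [X in _ * X]/Rintegral eps1 mulr0 subr0.
have int : P.-integrable setT (EFin \o (fun w => sin (0 + t * eps i w) - t * eps i w)).
  have := iD (isin t 0 (meps i)) (iZ (- t) (i1 i)).
  by apply: eq_integrable => // w _; rewrite /= mulNr.
apply: le_trans (le_normr_Rintegral _ int) _ => //.
(* The third absolute moment is split by [x^3 / 6 <= (x^2 + x^4) / 12], which is
   [0 <= (x * (x - 1)) ^+ 2] up to a factor. *)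
apply: (@le_trans _ _ (`|t| ^+ 3 / 12 + `|t| ^+ 3 / 12 * m4 i)); last first.
  have t3 : 0 <= `|t| ^+ 3 by rewrite exprn_ge0.
  by have := m4_le i; have := m4_ge0 i; move=> *; nra.
rewrite -[X in _ <= X + _]add0r -Rintegral_quartic; apply: (le_Rintegral measurableT (integrable_norm int) (integrable_quartic _ _ _ _)).
  move=> w _ /=; rewrite !add0r; apply: le_trans (sin_sub_id_le _) _.
  rewrite normrM exprMn; set x := `|eps i w|.
  have -> : eps i w ^+ 2 = x ^+ 2 by rewrite /x -normrX ger0_norm ?sqr_ge0.
  have -> : eps i w ^+ 4 = x ^+ 4 by rewrite /x -normrX ger0_norm ?exprn_even_ge0.
  rewrite -subr_ge0 (_ : _ - _ = `|t| ^+ 3 / 12 * (x * (x - 1)) ^+ 2); last by field.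
  by rewrite mulr_ge0 ?sqr_ge0// divr_ge0// exprn_ge0.
Qed.

Variable a : 'I_n -> R.
Notation S := (partial_sum eps a).

Let mS j : measurable_fun setT (S j). Proof. exact: measurable_partial_sum. Qed.

Let sumS (h : 'I_n -> R) (j : 'I_n) :
  \sum_(i < n | (i < j.+1)%N) h i = \sum_(i < n | (i < j)%N) h i + h j.
Proof.
rewrite (bigD1 j)//= addrC; congr (_ + _); apply: eq_bigl => i.
by rewrite ltnS ltn_neqAle andbC.
Qed.

Let err t := (M + 3) * t ^+ 4 + (M + 3) * `|t| ^+ 3.

(* Lindeberg replacement: peeling off one summand multiplies the cosine
   transform by [exp (- a_j^2 / 2)] up to [err a_j], uniformly in the phase. *)
Lemma partial_sum_cos (j : nat) (c : R) : (j <= n)%N ->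
  `|\int[P]_w cos (c + S j w) -
    cos c * expR (- ((\sum_(i < n | (i < j)%N) a i ^+ 2) / 2))| <=
  \sum_(i < n | (i < j)%N) err (a i).
Proof.
elim: j c => [|j IH] c jn.
  rewrite !big_pred0// mul0r oppr0 expR0 mulr1.
  rewrite (@eq_Rintegral _ _ _ _ _ (fun=> cos c)) ?Rcst ?subrr ?normr0//.
  by move=> w _; rewrite partial_sum0 addr0.
pose j' := Ordinal jn; rewrite (sumS (fun i => a i ^+ 2) j') (sumS (fun i => err (a i)) j').
have iC := icos 1 c (mS j); have iSn := isin 1 c (mS j).
have ic := icos (a j') 0 (meps j'); have is_ := isin (a j') 0 (meps j').
have ind := @partial_sum_independent _ _ _ _ _ _ meps ieps a j'.
have mcx : measurable_fun setT (fun x : R => cos (c + 1 * x)).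
  by apply: measurable_cos_comp; apply: measurable_funD => //; exact: measurable_funM.
have msx : measurable_fun setT (fun x : R => sin (c + 1 * x)).
  by apply: measurable_sin_comp; apply: measurable_funD => //; exact: measurable_funM.
have mcy : measurable_fun setT (fun x : R => cos (0 + a j' * x)).
  by apply: measurable_cos_comp; apply: measurable_funD => //; exact: measurable_funM.
have msy : measurable_fun setT (fun x : R => sin (0 + a j' * x)).
  by apply: measurable_sin_comp; apply: measurable_funD => //; exact: measurable_funM.
have iCc := independent_integrable (mS j) (meps j') ind mcx mcy iC ic.
have iSs := independent_integrable (mS j) (meps j') ind msx msy iSn is_.
have -> : \int[P]_w cos (c + S j.+1 w) =
    \int[P]_w cos (c + 1 * S j w) * \int[P]_w cos (0 + a j' * eps j' w) -
    \int[P]_w sin (c + 1 * S j w) * \int[P]_w sin (0 + a j' * eps j' w).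
  rewrite -(independent_Rintegral (mS j) (meps j') ind mcx mcy iC ic).
  rewrite -(independent_Rintegral (mS j) (meps j') ind msx msy iSn is_).
  rewrite -RintegralB//; apply: eq_Rintegral => w _.
  by rewrite -[j.+1]/(j'.+1) partial_sumS addrA [LHS]cosD !mul1r !add0r.
have := IH c (ltnW jn).
rewrite [X in `|X - _| <= _](_ : _ = \int[P]_w cos (c + 1 * S j w)); last first.
  by apply: eq_Rintegral => w _; rewrite mul1r.
set s2 := \sum_(i < n | (i < j)%N) a i ^+ 2.
set A := \int[P]_w cos (c + 1 * S j w).
set B := \int[P]_w sin (c + 1 * S j w).
have A1 : `|A| <= 1.
  apply: le_trans (le_normr_Rintegral measurableT iC) _.
  rewrite -[leRHS](Rcst 1); apply: (le_Rintegral measurableT (integrable_norm iC) (icst 1)) => w _; exact: cos_norm_le1.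
have B1 : `|B| <= 1.
  apply: le_trans (le_normr_Rintegral measurableT iSn) _.
  rewrite -[leRHS](Rcst 1); apply: (le_Rintegral measurableT (integrable_norm iSn) (icst 1)) => w _; exact: sin_norm_le1.
have := cos_eps j' (a j'); have := sin_eps j' (a j').
set g := \int[P]_w cos _; set h := \int[P]_w sin _; set G := expR (- (a j' ^+ 2 / 2)).
have -> : expR (- ((s2 + a j' ^+ 2) / 2)) = expR (- (s2 / 2)) * G.
  by rewrite /G -expRD; congr expR; field.
have G1 : `|G| <= 1.
  by rewrite ger0_norm ?expR_ge0// -expR0 ler_expR oppr_le0 divr_ge0// sqr_ge0.
set Pi := expR (- (s2 / 2)) => hh hg hA.
(* The factor [h] is small by itself, so of the sine transform [B] only [|B| <= 1] is used. The last
   term carries the induction error, which [|G| <= 1] does not enlarge. *)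
have -> : A * g - B * h - cos c * (Pi * G) =
    A * (g - G) + (- B) * h + G * (A - cos c * Pi) by ring.
apply: le_trans (ler_normD _ _) _; rewrite [leRHS]addrC; apply: lerD.
  apply: le_trans (ler_normD _ _) _; rewrite /err; apply: lerD.
    by rewrite normrM; apply: le_trans hg; rewrite ler_piMl.
  by rewrite normrM normrN; apply: le_trans hh; rewrite ler_piMl.
by rewrite normrM; apply: le_trans hA; rewrite ler_piMl.
Qed.

(** The cross terms vanish by independence and centring. These moments supply the uniform
    second-moment bound that controls the tails of the posterior means. *)
Lemma partial_sum_moments (j : nat) : (j <= n)%N ->
  [/\ P.-integrable setT (EFin \o S j),
      P.-integrable setT (EFin \o (fun w => S j w ^+ 2)),
      \int[P]_w S j w = 0 &
      \int[P]_w S j w ^+ 2 = \sum_(i < n | (i < j)%N) a i ^+ 2].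
Proof.
elim: j => [_|j IH jn].
  have -> : S 0 = fun=> 0 by apply/funext => w; rewrite partial_sum0.
  by rewrite Rcst expr0n/= Rcst big_pred0.
have [iS iS2 S1 S2] := IH (ltnW jn); pose j' := Ordinal jn.
rewrite (sumS (fun i => a i ^+ 2) j').
have ind := @partial_sum_independent _ _ _ _ _ _ meps ieps a j'.
have iSe := independent_integrable (mS j) (meps j') ind
  (@measurable_id _ _ setT) (@measurable_id _ _ setT) iS (i1 j').
have ESe := independent_Rintegral (mS j) (meps j') ind
  (@measurable_id _ _ setT) (@measurable_id _ _ setT) iS (i1 j').
have SE : S j.+1 = fun w => S j w + a j' * eps j' w.
  by apply/funext => w; rewrite -[j.+1]/(j'.+1) partial_sumS.
have S2E : (fun w => S j.+1 w ^+ 2) = (fun w => S j w ^+ 2 +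
    ((2 * a j') * (S j w * eps j' w) + a j' ^+ 2 * eps j' w ^+ 2)).
  by apply/funext => w; rewrite SE; ring.
have e1 : \int[P]_w eps j' w = 0 by rewrite /Rintegral eps1.
have e2 : \int[P]_w eps j' w ^+ 2 = 1 by rewrite /Rintegral eps2.
split.
- by rewrite SE; apply: iD => //; exact/iZ/i1.
- by rewrite S2E; apply: iD => //; apply: iD; exact: iZ.
- rewrite SE RintegralD//; last exact/iZ/i1.
  by rewrite S1 (RintegralZl _ measurableT (i1 j')) e1 mulr0 addr0.
- rewrite S2E RintegralD//; last by apply: iD; exact: iZ.
  rewrite S2 RintegralD//; last 2 first.
  + exact: iZ.
  + exact: iZ.
  by rewrite !RintegralZl// ESe e1 e2 !mulr0 add0r mulr1.
Qed.

End lindeberg.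

(** * Weak convergence through trigonometric polynomials *)

Section cvg_bigop.
Context (R : realType) (T : Type) (F : set_system T) {FF : Filter F}.

Lemma cvg_sumr (I : Type) (s : seq I) (f : I -> T -> R) (l : I -> R) :
  (forall i, f i x @[x --> F] --> l i) ->
  \sum_(i <- s) f i x @[x --> F] --> \sum_(i <- s) l i.
Proof.
move=> fl; elim: s => [|i s IH].
  by rewrite big_nil; under eq_fun do rewrite big_nil; exact: cvg_cst.
rewrite big_cons; under eq_fun do rewrite big_cons.
exact: (@cvgD _ R^o).
Qed.

Lemma cvg_prodr (I : Type) (s : seq I) (f : I -> T -> R) (l : I -> R) :
  (forall i, f i x @[x --> F] --> l i) ->
  \prod_(i <- s) f i x @[x --> F] --> \prod_(i <- s) l i.
Proof.
move=> fl; elim: s => [|i s IH].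
  by rewrite big_nil; under eq_fun do rewrite big_nil; exact: cvg_cst.
rewrite big_cons; under eq_fun do rewrite big_cons.
exact: cvgM.
Qed.

End cvg_bigop.

Section trigonometric_polynomials.
Variables (R : realType) (K : nat).
Notation V := 'cV[R]_K.
Implicit Types (f g p q : V -> R) (u x y : V) (c e : R).

(** The phase makes constants ([u = 0]) and sines instances of a single generator, and
    product-to-sum formulas close the class under products. *)
Inductive trig_poly : (V -> R) -> Prop :=
| trig_cos c u : trig_poly (fun x => cos (c + (u^T *m x) 0 0))
| trig_add p q : trig_poly p -> trig_poly q -> trig_poly (fun x => p x + q x)
| trig_scale c p : trig_poly p -> trig_poly (fun x => c * p x).

Lemma eq_trig_poly p q : p =1 q -> trig_poly p -> trig_poly q.
Proof. by move=> /funext ->. Qed.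

Lemma trig_cst c : trig_poly (fun=> c).
Proof.
apply: eq_trig_poly (trig_scale c (trig_cos 0 0)) => x.
by rewrite trmx0 mul0mx mxE addr0 cos0 mulr1.
Qed.

Lemma trig_sub p q : trig_poly p -> trig_poly q -> trig_poly (fun x => p x - q x).
Proof.
move=> tp tq; apply: eq_trig_poly (trig_add tp (trig_scale (-1) tq)) => x.
by rewrite mulN1r.
Qed.

Lemma trig_mul p q : trig_poly p -> trig_poly q -> trig_poly (fun x => p x * q x).
Proof.
move=> tp; elim: tp q => [c u|p1 p2 _ IH1 _ IH2|c p1 _ IH] q tq.
- elim: tq => [c' u'|q1 q2 _ IH1 _ IH2|c' q1 _ IH].
  + apply: eq_trig_poly (trig_scale 2^-1 (trig_add (trig_cos (c + c') (u + u'))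
      (trig_cos (c - c') (u - u')))) => x.
    rewrite !raddfD/= !raddfN/= !mulmxDl mulNmx !mxE.
    set s := \sum_j _; set s' := \sum_j _.
    rewrite (_ : c + c' + (s + s') = (c + s) + (c' + s')); last by ring.
    rewrite (_ : c - c' + (s - s') = (c + s) - (c' + s')); last by ring.
    by rewrite cosD cosB; field.
  + by apply: eq_trig_poly (trig_add IH1 IH2) => x; rewrite mulrDr.
  + by apply: eq_trig_poly (trig_scale c' IH) => x; rewrite mulrCA.
- by apply: eq_trig_poly (trig_add (IH1 q tq) (IH2 q tq)) => x; rewrite mulrDl.
- by apply: eq_trig_poly (trig_scale c (IH q tq)) => x; rewrite mulrA.
Qed.

Lemma trig_bounded p : trig_poly p -> exists2 B, 0 < B & forall x, `|p x| <= B.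
Proof.
elim=> [c u|p1 p2 _ [B1 B10 H1] _ [B2 B20 H2]|c p1 _ [B B0 H]].
- by exists 1 => // x; rewrite ler_norml cos_geN1 cos_le1.
- exists (B1 + B2) => [|x]; first exact: addr_gt0.
  by apply: le_trans (ler_normD _ _) _; exact: lerD.
- exists ((`|c| + 1) * B) => [|x]; first by rewrite mulr_gt0// ltr_wpDl.
  by rewrite normrM; apply: ler_pM => //; rewrite lerDl.
Qed.

Lemma dot_continuous u : continuous (fun x : V => (u^T *m x) 0 0).
Proof.
move=> x; rewrite (_ : (fun x : V => _) = (fun x : V => \sum_j u^T 0 j * x j 0)); last first.
  by apply/funext => z; rewrite mxE.
have H (j : 'I_K) : (fun z : V => u^T 0 j * z j 0) @ nbhs x --> u^T 0 j * x j 0.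
  by apply: cvgM; [exact: cvg_cst|exact: coord_continuous].
exact: (@cvg_sumr R V (nbhs x) _ _ _ _ _ H).
Qed.

Lemma trig_continuous p : trig_poly p -> continuous p.
Proof.
elim=> [c u|p1 p2 _ H1 _ H2|c p1 _ H] x.
- apply: (@continuous_comp _ _ _ (fun x : V => c + (u^T *m x) 0 0) (@cos R)).
    have H := @dot_continuous u x.
    exact: (@cvgD _ R^o V (nbhs x) _ _ _ _ _ (cvg_cst c) H).
  exact: continuous_cos.
- exact: (@cvgD _ R^o V (nbhs x) _ _ _ _ _ (H1 x) (H2 x)).
- exact: (@cvgM R V (nbhs x) _ _ _ _ _ (cvg_cst c) (H x)).
Qed.

Lemma trig_measurable d (T : measurableType d) (X : T -> V) p :
  (forall k, measurable_fun setT (fun w => X w k 0)) -> trig_poly p ->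
  measurable_fun setT (fun w => p (X w)).
Proof.
move=> mX; elim=> [c u|p1 p2 _ H1 _ H2|c p1 _ H].
- apply: measurable_cos_comp; apply: measurable_funD => //.
  under eq_fun do rewrite mxE.
  by apply: measurable_sum => j; exact: measurable_funM.
- exact: measurable_funD.
- exact: measurable_funM.
Qed.

Definition trig_closure f : Prop :=
  forall e, 0 < e -> exists2 p, trig_poly p & forall x, `|f x - p x| <= e.

Lemma trig_closure_poly p : trig_poly p -> trig_closure p.
Proof. by move=> tp e e0; exists p => // x; rewrite subrr normr0 ltW. Qed.

(* Iteration for the square root of [p ^+ 2]: the error satisfies
   [|p| - h_(k+1) = (|p| - h_k) * (1 - (|p| + h_k) / 2)]. *)
Fixpoint abs_approx p (k : nat) : V -> R :=
  if k is k'.+1 then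
    fun x => abs_approx p k' x + 2^-1 * (p x * p x - abs_approx p k' x * abs_approx p k' x)
  else fun=> 0.

Lemma trig_abs_approx p k : trig_poly p -> trig_poly (abs_approx p k).
Proof.
move=> tp; elim: k => [|k IH] /=; first exact: trig_cst.
apply: trig_add => //; apply: trig_scale; apply: trig_sub; exact: trig_mul.
Qed.

(** The third clause yields an error of at most [2 / k] uniformly in [x], including near the zeros
    of [p], where the iteration contracts slowly. *)
Lemma abs_approx_bound p k x : `|p x| <= 1 ->
  [/\ 0 <= abs_approx p k x, abs_approx p k x <= `|p x| &
      (`|p x| - abs_approx p k x) * (2 + k%:R * `|p x|) <= 2 * `|p x|].
Proof.
set t := `|p x| => t1; have t0 : 0 <= t by exact: normr_ge0.
elim: k => [|k [h0 ht hk]] /=.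
  by rewrite subr0 mul0r addr0 [t * 2]mulrC; split.
have pp : p x * p x = t * t by rewrite -!expr2 /t real_normK// num_real.
rewrite pp; set h := abs_approx p k x in h0 ht hk *.
have k0 : 0 <= k%:R :> R by exact: ler0n.
have dE : t - (h + 2^-1 * (t * t - h * h)) = (t - h) * (1 - (t + h) / 2) by field.
have d0 : 0 <= (t - h) * (1 - (t + h) / 2) by rewrite mulr_ge0; lra.
split.
- have : 0 <= 2^-1 * (t * t - h * h) by rewrite mulr_ge0//; nra.
  by move=> ?; rewrite addr_ge0.
- by rewrite -subr_ge0 dE.
- rewrite dE -[k.+1%:R]natr1.
  (* Dropping [h] from the contraction factor leaves [(1 - t / 2) * (2 + (k + 1) * t)], which falls
     short of [2 + k * t] by [(k + 1) * t^2 / 2]. *)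
  apply: (@le_trans _ _ ((t - h) * ((1 - t / 2) * (2 + (k%:R + 1) * t)))).
    rewrite -mulrA ler_wpM2l ?subr_ge0//; apply: ler_wpM2r; last by lra.
    by rewrite addr_ge0// mulr_ge0// addr_ge0.
  apply: le_trans hk; rewrite ler_wpM2l ?subr_ge0//.
  have : 0 <= (k%:R + 1) * t ^+ 2 by rewrite mulr_ge0 ?sqr_ge0// addr_ge0.
  by rewrite expr2 => H; rewrite -subr_ge0 (_ : _ - _ = 2^-1 * ((k%:R + 1) * (t * t))); [rewrite mulr_ge0|field].
Qed.

Lemma trig_closure_abs p : trig_poly p -> trig_closure (fun x => `|p x|).
Proof.
move=> tp e e0; have [B B0 pB] := trig_bounded tp.
have Bi : 0 <= B^-1 by rewrite invr_ge0 ltW.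
pose g x := B^-1 * p x; have tg : trig_poly g by exact: trig_scale.
have g1 x : `|g x| <= 1.
  by rewrite /g normrM (ger0_norm Bi) mulrC ler_pdivrMr// mul1r.
(* After scaling by the sup bound [B] the error is at most [2 * B / k]. *)
have [k kP] : exists k : nat, 2 * B / e < k%:R.
  by exists (Num.bound (2 * B / e)); apply: archi_boundP; rewrite divr_ge0 ?mulr_ge0// ltW.
have k0 : 0 < k%:R :> R by apply: le_lt_trans kP; rewrite divr_ge0 ?mulr_ge0 ?ltW.
exists (fun x => B * abs_approx g k x).
  by apply: trig_scale; exact: trig_abs_approx.
move=> x; have [h0 h1 h2] := abs_approx_bound k (g1 x).
have -> : `|p x| = B * `|g x|.
  by rewrite normrM (ger0_norm Bi) mulrA divff ?mul1r// gt_eqF.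
rewrite -mulrBr ger0_norm; last by rewrite mulr_ge0 ?subr_ge0// ltW.
set t := `|g x| in h1 h2 *; set D := t - _ in h2 *.
have D0 : 0 <= D by rewrite subr_ge0.
have Dk : D * k%:R <= 2.
  have [t0|t0] := eqVneq t 0.
    by have -> : D = 0; [apply/eqP; rewrite eq_le D0 andbT /D t0 sub0r oppr_le0|rewrite mul0r].
  have tp0 : 0 < t by rewrite lt0r t0 normr_ge0.
  rewrite -(ler_pM2r tp0) -mulrA; apply: le_trans h2.
  by rewrite ler_wpM2l// lerDr.
rewrite -(ler_pM2r k0) -mulrA; apply: (@le_trans _ _ (B * 2)).
  by rewrite ler_wpM2l// ltW.
by move: kP; rewrite ltr_pdivrMr// => /ltW; rewrite mulrC [k%:R * _]mulrC.
Qed.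

Lemma trig_closure_scale c f : trig_closure f -> trig_closure (fun x => c * f x).
Proof.
move=> tf e e0; have c0 : 0 < `|c| + 1 by rewrite ltr_wpDl.
have [|p tp fp] := tf (e / (`|c| + 1)); first exact: divr_gt0.
exists (fun x => c * p x); first exact: trig_scale.
move=> x; rewrite -mulrBr normrM.
apply: (@le_trans _ _ ((`|c| + 1) * (e / (`|c| + 1)))); last by rewrite mulrC divfK// gt_eqF.
by apply: ler_pM => //; rewrite lerDl.
Qed.

Lemma trig_closure_max f g : trig_closure f -> trig_closure g ->
  trig_closure (fun x => Num.max (f x) (g x)).
Proof.
(* For [max = (f + g + |f - g|) / 2] the total error is half of [2/3 e + (2/3 e + 1/3 e)], that is
   [5/6 e]. *)
move=> tf tg e e0; have e3 : 0 < e / 3 by rewrite divr_gt0.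
have [p tp fp] := tf _ e3; have [q tq gq] := tg _ e3.
have [r tr pqr] := trig_closure_abs (trig_sub tp tq) e3.
exists (fun x => 2^-1 * ((p x + q x) + r x)).
  by apply: trig_scale; apply: trig_add => //; exact: trig_add.
move=> x; have := fp x; have := gq x; have := pqr x.
rewrite maxr_absE !ler_norml => /andP[h1 h2] /andP[h3 h4] /andP[h5 h6].
have h7 : `| `|f x - g x| - `|p x - q x| | <= 2 * (e / 3).
  apply: le_trans (ler_dist_dist _ _) _.
  by rewrite ler_norml; apply/andP; split; lra.
by move: h7; rewrite ler_norml => /andP[h7 h8]; apply/andP; split; lra.
Qed.

Lemma trig_closure_min f g : trig_closure f -> trig_closure g ->
  trig_closure (fun x => Num.min (f x) (g x)).
Proof.
move=> tf tg.
have := trig_closure_scale (-1) (trig_closure_max (trig_closure_scale (-1) tf) (trig_closure_scale (-1) tg)).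
congr trig_closure; apply/funext => x.
by rewrite !mulN1r -oppr_min opprK.
Qed.

Lemma trig_closure_bigmax (I : Type) (s : seq I) (h : I -> V -> R) c :
  (forall i, trig_closure (h i)) ->
  trig_closure (fun x => \big[Num.max/c]_(i <- s) h i x).
Proof.
move=> th; elim: s => [|i s IH].
  by under eq_fun do rewrite big_nil; exact/trig_closure_poly/trig_cst.
by under eq_fun do rewrite big_cons; exact: trig_closure_max.
Qed.

End trigonometric_polynomials.

(** * Approximation on a box with a global bound *)

Section trigonometric_approximation.
Variables (R : realType) (K : nat).
Notation V := 'cV[R]_K.
Implicit Types (f g p q : V -> R) (u x y : V) (c e : R).

Lemma cV_box_compact (r : R) : compact [set x : V | forall k, `|x k 0| <= r].
Proof.
have tr_continuous : continuous (fun z : 'rV[R]_K => z^T : V).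
  move=> z A /nbhs_ballP[e e0 eA]; apply/nbhs_ballP; exists e => // y [_ zy].
  by apply: eA; split => // i j; rewrite !mxE; exact: zy.
have -> : [set x : V | forall k, `|x k 0| <= r] =
    (fun z : 'rV[R]_K => z^T : V) @` [set z : 'rV[R]_K | forall k, z ord0 k \in `[- r, r]].
  apply/seteqP; split => x /=.
    by move=> xr; exists x^T; rewrite ?trmxK// => k; rewrite mxE in_itv/= -ler_norml.
  by move=> [z zr <-] k; rewrite mxE ler_norml; have := zr k; rewrite in_itv.
apply: continuous_compact; first exact: continuous_subspaceT.
apply: (@rV_compact R K (fun=> `[- r, r]%classic)) => _.
exact: segment_compact.
Qed.

(** A nonnegative trigonometric polynomial vanishing at [y], used as a penalty for moving away from
    [y]. *)
Let bump (dl : R) y x : R := \sum_k (1 - cos (dl * (x k 0 - y k 0))).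

Let trig_bump dl y : trig_poly (bump dl y).
Proof.
rewrite /bump; elim: (index_enum _) => [|k s IH].
  by apply: eq_trig_poly (trig_cst _ 0) => x; rewrite big_nil.
have := trig_add (trig_sub (trig_cst _ 1)
  (trig_cos (- (dl * y k 0)) (dl *: delta_mx k 0))) IH.
apply: eq_trig_poly => x; rewrite big_cons; congr (1 - cos _ + _).
rewrite mxE (bigD1 k)//= big1 => [|j /negbTE jk]; rewrite !mxE ?eqxx ?jk/=; ring.
Qed.

Let bump_ge0 dl y x : 0 <= bump dl y x.
Proof. by apply: sumr_ge0 => k _; rewrite subr_ge0 cos_le1. Qed.

(** Near [y], continuity bounds [f y] by [f x + e]; farther away in the box the penalty is at least
    [2 * C], the largest possible gap between values of [f]. *)
Let minorant f C e r y : {for y, continuous f} -> (forall x, `|f x| <= C) ->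
  0 < e -> 0 < r -> (forall k, `|y k 0| <= r) ->
  exists2 h, trig_poly h & h y = f y /\
    forall x, (forall k, `|x k 0| <= r) -> h x <= f x + e.
Proof.
move=> fy fC e0 r0 yr.
have C0 : 0 <= C by apply: le_trans (fC y).
have /nbhs_ballP[rho /= rho0 near_y] : nbhs y [set x | `|f y - f x| < e].
  by have /cvgrPdist_lt := fy; apply.
(* Coordinates of two points of the box differ by at most [2 * r], so the phases stay in [[0, pi]]
   in absolute value, where the cosine decreases. *)
pose dl := pi / (2 * r); have pi0 := pi_gt0 R.
have dl0 : 0 < dl by rewrite divr_gt0// mulr_gt0.
(* The cap by [r] keeps [dl * rho'] in that half period, so [eta] bounds the penalty from below
   outside the cube of radius [rho']. *)
pose rho' := Num.min rho r.
have rho'0 : 0 < rho' by rewrite lt_min rho0.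
have dlr : dl * (2 * r) = pi by rewrite /dl divfK// gt_eqF// mulr_gt0.
have dlrho : dl * rho' <= pi.
  rewrite -dlr; apply: ler_wpM2l; first exact: ltW.
  apply: (@le_trans _ _ r); first by rewrite ge_min lexx orbT.
  by lra.
pose eta := 1 - cos (dl * rho').
have eta0 : 0 < eta.
  rewrite subr_gt0 -cos0 ltr_cos ?in_itv/=; first by rewrite mulr_gt0.
  - by rewrite lexx ltW.
  - by rewrite dlrho andbT mulr_ge0// ltW.
pose L := 2 * C / eta; have L0 : 0 <= L by rewrite divr_ge0 ?mulr_ge0// ltW.
exists (fun x => f y - L * bump dl y x).
  by apply: trig_sub; [exact: trig_cst|apply: trig_scale; exact: trig_bump].
split.
  by rewrite /bump big1 ?mulr0 ?subr0// => k _; rewrite subrr mulr0 cos0 subrr.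
move=> x xr; have [xy|/existsNP[k /negP]] := pselect (forall k, `|y k 0 - x k 0| < rho').
  have : `|f y - f x| < e.
    apply: near_y; split => // i j; rewrite /ball/= ord1.
    by apply: lt_le_trans (xy i) _; rewrite ge_min lexx.
  move=> /ltr_normlW fyx; have := mulr_ge0 L0 (bump_ge0 dl y x).
  by move=> ?; lra.
rewrite -leNgt => ky.
have bk : eta <= bump dl y x.
  rewrite /bump (bigD1 k)//=; apply: (@le_trans _ _ (1 - cos (dl * (x k 0 - y k 0)))); last first.
    by rewrite lerDl; apply: sumr_ge0 => j _; rewrite subr_ge0 cos_le1.
  rewrite lerD2l lerN2 -[X in X <= _]cos_norm normrM (gtr0_norm dl0) distrC.
  have xy2 : `|y k 0 - x k 0| <= 2 * r.
    apply: le_trans (ler_normB _ _) _; have := yr k; have := xr k.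
    by move=> *; lra.
  have [->//|neq] := eqVneq `|y k 0 - x k 0| rho'.
  rewrite ltW// ltr_cos ?in_itv/=; first by rewrite ltr_pM2l// lt_neqAle eq_sym neq.
  - by rewrite dlrho andbT mulr_ge0// ltW.
  - apply/andP; split; first by rewrite mulr_ge0// ltW.
    by rewrite -dlr; apply: ler_wpM2l => //; exact: ltW.
have : 2 * C <= L * bump dl y x.
  apply: (@le_trans _ _ (L * eta)); last by rewrite ler_wpM2l.
  by rewrite /L divfK// gt_eqF.
have := fC x; have := fC y; rewrite !ler_norml => /andP[_ h1] /andP[h2 _] h3.
by lra.
Qed.

(** Lattice form of the Stone-Weierstrass argument: by compactness finitely many minorants exceed
    [f - e / 2] on the box, so their maximum is within [e / 2] of [f] there. *)
Lemma trig_approximation f C e r : continuous f -> (forall x, `|f x| <= C) ->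
  0 < e -> 0 < r -> exists q, [/\ trig_poly q,
    forall x, (forall k, `|x k 0| <= r) -> `|f x - q x| <= e &
    forall x, `|q x| <= C + e].
Proof.
move=> cf fC e0 r0; have e2 : 0 < e / 2 by rewrite divr_gt0.
pose box := [set x : V | forall k, `|x k 0| <= r].
have C0 : 0 <= C by apply: le_trans (fC 0).
have hex y : exists h, trig_poly h /\ (box y -> h y = f y /\
    forall x, box x -> h x <= f x + e / 2).
  have [by_|nby] := pselect (box y).
    by have [h th hP] := minorant (cf y) fC e2 r0 by_; exists h.
  by exists (fun=> 0); split => //; exact: trig_cst.
have [h hP] := choice hex.
pose U y := [set x | f x - e / 2 < h y x]°.
have Uo y : box y -> open (U y) by move=> _; exact: open_interior.
have Uc : box `<=` \bigcup_(y in box) U y.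
  move=> y by_; exists y => //; rewrite /U /interior.
  have [th /(_ by_)[hy _]] := hP y.
  have H := (@cvgB _ R^o V (nbhs y) _ _ _ _ _ (@trig_continuous _ _ _ th y) (cf y)).
  have /cvgrPdist_lt/(_ _ e2) : (h y - f) x @[x --> nbhs y] --> h y y - f y by exact: H.
  apply: filterS => x /=; rewrite hy subrr sub0r normrN -[(h y - f) x]/(h y x - f x).
  by rewrite ltr_norml => /andP[? _]; lra.
have := @cV_box_compact r; rewrite compact_cover => /(_ _ _ _ Uo Uc)[D DB boxD].
(* The seed [- C] of the maximum and the cap [C] act on the whole space, not only on the box; this
   gives the bound on [q] that is independent of [r]. *)
pose g x := Num.min (\big[Num.max/- C]_(y <- finmap.enum_fset D) h y x) C.
have tg : trig_closure g.
  apply: trig_closure_min; last exact/trig_closure_poly/trig_cst.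
  by apply: trig_closure_bigmax => y; apply: trig_closure_poly; have [] := hP y.
have [q tq gq] := tg _ e2.
have g1 x : - C <= g x.
  rewrite /g le_min; apply/andP; split; last by lra.
  by elim: (finmap.enum_fset D) => [|y s IH]; rewrite ?big_nil// big_cons le_max IH orbT.
have g2 x : g x <= C by rewrite /g ge_min lexx orbT.
have gf x : box x -> f x - e / 2 <= g x <= f x + e / 2.
  move=> bx; have := fC x; rewrite ler_norml => /andP[f1 f2].
  apply/andP; split.
    rewrite /g le_min; apply/andP; split; last by lra.
    have [y /= yD] := boxD _ bx; rewrite /U => /interior_subset /= /ltW xh.
    have {}yD : y \in finmap.enum_fset D by [].
    elim: (finmap.enum_fset D) yD => // z s IH.
    by rewrite inE big_cons le_max => /orP[/eqP <-|/IH ->]; rewrite ?xh ?orbT.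
  rewrite /g ge_min; apply/orP; left.
  have {}DB : forall y, y \in finmap.enum_fset D -> box y.
    by move=> y yD; have := DB y yD; rewrite inE.
  elim: (finmap.enum_fset D) DB => [|y s IH] DB; rewrite ?big_nil ?big_cons; first by lra.
  rewrite ge_max IH ?andbT => [|z zs]; last by apply: DB; rewrite inE zs orbT.
  by have [_ /(_ (DB y (mem_head _ _)))[_]] := hP y; exact.
exists q; split => // x.
  move=> /gf /andP[h1 h2]; have := gq x; rewrite !ler_norml => /andP[h3 h4].
  by apply/andP; split; lra.
have := gq x; have := g1 x; have := g2 x; rewrite !ler_norml => h1 h2 /andP[h3 h4].
by apply/andP; split; lra.
Qed.

(** Only the coordinates of [X] are known to be measurable; [f] of [X] is a pointwise limit of
    trigonometric polynomials of [X], taken on growing boxes. *)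
Lemma measurable_continuous_comp d (T : measurableType d) (X : T -> V) f C :
  (forall k, measurable_fun setT (fun w => X w k 0)) ->
  continuous f -> (forall x, `|f x| <= C) ->
  measurable_fun setT (fun w => f (X w)).
Proof.
move=> mX cf fC.
have ex m : exists q, [/\ trig_poly q,
    forall x, (forall k, `|x k 0| <= m.+1%:R) -> `|f x - q x| <= m.+1%:R^-1 &
    forall x, `|q x| <= C + m.+1%:R^-1].
  by apply: trig_approximation => //; rewrite ?invr_gt0 ltr0n.
have [q qP] := choice ex.
apply: (@measurable_fun_cvg _ _ _ _ (fun m w => q m (X w))).
  by move=> m; have [tq _ _] := qP m; exact: trig_measurable tq.
move=> w _; apply/cvgrPdist_le => e e0.
pose B := \sum_k `|X w k 0|.
near=> m; have [_ /(_ (X w)) H _] := qP m.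
apply: le_trans (H _) _ => [k|].
  apply: (@le_trans _ _ B); first by rewrite /B (bigD1 k)//= lerDl sumr_ge0.
  by apply: (@le_trans _ _ m%:R); [near: m; exact: nbhs_infty_ger|rewrite ler_nat].
by apply: ltW; near: m; exact: (near_infty_natSinv_lt (PosNum e0)).
Unshelve. all: by end_near. Qed.

End trigonometric_approximation.

Section integral_helpers.
Context d (T : measurableType d) (R : realType) (P : probability T R).

Lemma Rintegral_probability_cst (r : R) : \int[P]_(w in setT) r = r.
Proof. by rewrite Rintegral_cst//= probability_setT mulr1. Qed.

Lemma integrable_Rsum (I : Type) (s : seq I) (g : I -> T -> R) :
  (forall i, P.-integrable setT (EFin \o g i)) ->
  P.-integrable setT (EFin \o (fun w => \sum_(i <- s) g i w)) /\
  \int[P]_w (\sum_(i <- s) g i w) = \sum_(i <- s) \int[P]_w g i w.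
Proof.
move=> ig; elim: s => [|i s [IH1 IH2]].
  under eq_fun do rewrite big_nil.
  by split; [exact: finite_measure_integrable_cst|rewrite big_nil Rintegral_probability_cst].
under eq_fun do rewrite big_cons.
split; last by rewrite RintegralD// IH2 big_cons.
rewrite /comp; under eq_fun do rewrite EFinD.
exact: (integrableD measurableT (ig i) IH1).
Qed.

Lemma trig_integrable (K : nat) (X : T -> 'cV[R]_K) (q : 'cV[R]_K -> R) :
  (forall k, measurable_fun setT (fun w => X w k 0)) -> trig_poly q ->
  P.-integrable setT (EFin \o (fun w => q (X w))).
Proof.
move=> mX tq; have [B _ qB] := trig_bounded tq.
by apply: (@integrable_bounded _ _ _ _ _ B) => //; exact: trig_measurable tq.
Qed.

(** Chebyshev's inequality inside the integral: outside the box some coordinate exceeds [r], so the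
    bound [2 * C + e] is at most itself times the sum of squares over [r ^+ 2]. *)
Lemma trig_approximation_error (K : nat) (X : T -> 'cV[R]_K)
    (f q : 'cV[R]_K -> R) (C e r B : R) :
  (forall k, measurable_fun setT (fun w => X w k 0)) ->
  (forall k, P.-integrable setT (EFin \o (fun w => X w k 0 ^+ 2)) /\
             \int[P]_w X w k 0 ^+ 2 <= B) ->
  continuous f -> (forall x, `|f x| <= C) -> 0 < e -> 0 < r -> trig_poly q ->
  (forall x : 'cV[R]_K, (forall k, `|x k 0| <= r) -> `|f x - q x| <= e) ->
  (forall x, `|q x| <= C + e) ->
  `|\int[P]_w f (X w) - \int[P]_w q (X w)| <=
    e + (2 * C + e) / r ^+ 2 * (K%:R * B).
Proof.
move=> mX X2 cf fC e0 r0 tq fq qC.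
have C0 : 0 <= C by apply: le_trans (fC 0).
have if_ : P.-integrable setT (EFin \o (fun w => f (X w))).
  apply: (@integrable_bounded _ _ _ _ _ C) => //.
  exact: measurable_continuous_comp cf fC.
have iq := trig_integrable mX tq.
have ifq : P.-integrable setT (EFin \o (fun w => f (X w) - q (X w))).
  by rewrite /comp; under eq_fun do rewrite EFinB; exact: integrableB.
rewrite -RintegralB//; apply: le_trans (le_normr_Rintegral measurableT ifq) _.
pose c := (2 * C + e) / r ^+ 2.
have c0 : 0 <= c by rewrite divr_ge0 ?sqr_ge0// addr_ge0 ?mulr_ge0// ltW.
have [is_ Es] := integrable_Rsum (index_enum 'I_K) (fun k => (X2 k).1).
have ics : P.-integrable setT (EFin \o (fun w => c * \sum_k X w k 0 ^+ 2)).
  by rewrite /comp; under eq_fun do rewrite EFinM; exact: integrableZl.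
have icst : P.-integrable setT (EFin \o (fun=> e)) by exact: finite_measure_integrable_cst.
have ib : P.-integrable setT (EFin \o (fun w => e + c * \sum_k X w k 0 ^+ 2)).
  by rewrite /comp; under eq_fun do rewrite EFinD; exact: integrableD.
apply: (@le_trans _ _ (\int[P]_w (e + c * \sum_k X w k 0 ^+ 2))).
  apply: (le_Rintegral measurableT (integrable_norm ifq) ib) => w _ /=.
  have [box|/existsNP[k /negP]] := pselect (forall k, `|X w k 0| <= r).
    apply: le_trans (fq _ box) _; rewrite lerDl mulr_ge0//.
    by apply: sumr_ge0 => k _; exact: sqr_ge0.
  rewrite -ltNge => kr; apply: (@le_trans _ _ (2 * C + e)).
    apply: le_trans (ler_normB _ _) _; have := fC (X w); have := qC (X w).
    by move=> *; lra.
  apply: (@le_trans _ _ (c * \sum_k X w k 0 ^+ 2)); last by rewrite lerDr ltW.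
  apply: (@le_trans _ _ (c * r ^+ 2)).
    by rewrite /c divfK// expf_neq0// gt_eqF.
  rewrite ler_wpM2l// (bigD1 k)//=; apply: (@le_trans _ _ (X w k 0 ^+ 2)).
    by rewrite -[leRHS]real_normK ?num_real// ler_sqr ?nnegrE ?normr_ge0 ?(ltW r0)// ltW.
  by rewrite lerDl; apply: sumr_ge0 => j _; exact: sqr_ge0.
rewrite RintegralD// Rintegral_probability_cst RintegralZl// Es lerD2l -/c ler_wpM2l//.
apply: (@le_trans _ _ (\sum_(k < K) B)); first by apply: ler_sum => k _; exact: (X2 k).2.
by rewrite sumr_const card_ord mulr_natl.
Qed.

End integral_helpers.

(** * From cosine transforms to convergence in distribution *)

Section weak_convergence_criterion.
Variables (R : realType) (K : nat) (d : nat -> measure_display).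
Variables (Omega : forall n, measurableType (d n)).
Variables (P : forall n, probability (Omega n) R).
Variables (Xn : forall n, Omega n -> 'cV[R]_K).
Variables (d' : measure_display) (Omega' : measurableType d').
Variables (Q : probability Omega' R) (L : Omega' -> 'cV[R]_K).
Variables (n1 : nat) (B : R).
Hypothesis mX : forall n, (n1 <= n)%N -> forall k,
  measurable_fun setT (fun w : Omega n => Xn w k 0).
Hypothesis mL : forall k, measurable_fun setT (fun w => L w k 0).
Hypothesis X2 : forall n, (n1 <= n)%N -> forall k,
  (P n).-integrable setT (EFin \o (fun w : Omega n => Xn w k 0 ^+ 2)) /\
  \int[P n]_w Xn w k 0 ^+ 2 <= B.
Hypothesis L2 : forall k, Q.-integrable setT (EFin \o (fun w => L w k 0 ^+ 2)) /\
  \int[Q]_w L w k 0 ^+ 2 <= B.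
Hypothesis cos_cvg : forall (c : R) (u : 'cV[R]_K),
  \int[P n]_w cos (c + (u^T *m Xn w) 0 0) @[n --> \oo] -->
  \int[Q]_w cos (c + (u^T *m L w) 0 0).

Let trig_cvg q : trig_poly q ->
  \int[P n]_w q (Xn w) @[n --> \oo] --> \int[Q]_w q (L w).
Proof.
elim=> [c u|p1 p2 t1 H1 t2 H2|c p t H]; first exact: cos_cvg.
- rewrite RintegralD//; [|exact: trig_integrable..].
  apply: cvg_trans (@cvgD _ R^o _ _ _ _ _ _ _ H1 H2).
  apply: near_eq_cvg; near=> n; apply/esym.
  have nn : (n1 <= n)%N by near: n; exact: nbhs_infty_ge.
  by rewrite RintegralD//; [exact: trig_integrable (mX nn) t1|exact: trig_integrable (mX nn) t2].
- rewrite RintegralZl//; last exact: trig_integrable.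
  apply: cvg_trans (cvgM (cvg_cst c) H).
  apply: near_eq_cvg; near=> n; apply/esym.
  have nn : (n1 <= n)%N by near: n; exact: nbhs_infty_ge.
  by rewrite RintegralZl//; exact: trig_integrable (mX nn) t.
Unshelve. all: by end_near. Qed.

Lemma cvg_in_distribution_cos : cvg_in_distribution P Xn Q L.
Proof.
move=> f cf [C fC].
have C0 : 0 <= C by apply: le_trans (fC 0).
have ibd n (nn : (n1 <= n)%N) : (P n).-integrable setT (EFin \o (fun w => f (Xn w))).
  apply: (@integrable_bounded _ _ _ _ _ C) => //.
  exact: measurable_continuous_comp (mX nn) cf fC.
have ibQ : Q.-integrable setT (EFin \o (fun w => f (L w))).
  apply: (@integrable_bounded _ _ _ _ _ C) => //.
  exact: measurable_continuous_comp mL cf fC.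
rewrite -[X in _ --> X]fineK; last exact: (integrable_fin_num measurableT ibQ).
apply/fine_cvgP; split.
  near=> n; apply: (integrable_fin_num measurableT (ibd n _)).
  by near: n; exact: nbhs_infty_ge.
apply/cvgrPdist_le => e0 e00.
(* The two approximation errors get [e0 / 4] each and the trigonometric limit [e0 / 2]. The cap 1
   replaces [2 * C + e] by a constant free of [e]. *)
pose e := Num.min 1 (e0 / 8).
have ep : 0 < e by rewrite lt_min ltr01 divr_gt0.
have e1 : e <= 1 by rewrite ge_min lexx.
have e8 : e <= e0 / 8 by rewrite ge_min lexx orbT.
pose B' := Num.max B 0; have B'0 : 0 <= B' by rewrite le_max lexx orbT.
have BB' : B <= B' by rewrite le_max lexx.
pose D := (2 * C + 1) * (K%:R * B').
have D0 : 0 <= D by rewrite !mulr_ge0// addr_ge0 ?mulr_ge0.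
(* This gives [D <= e0 / 8 * r]; the summand 1 ensures [r <= r ^+ 2], hence
   [D / r ^+ 2 <= e0 / 8]. *)
pose r := 8 * D / e0 + 1.
have r1 : 1 <= r.
  by rewrite /r lerDr; apply: divr_ge0; [exact: mulr_ge0|exact: ltW].
have r0 : 0 < r by apply: lt_le_trans r1.
have [q [tq fq qC]] := trig_approximation cf fC ep r0.
have bound : e + (2 * C + e) / r ^+ 2 * (K%:R * B') <= e0 / 4.
  apply: (@le_trans _ _ (e0 / 8 + e0 / 8)); last by lra.
  apply: lerD => //; apply: (@le_trans _ _ (D / r ^+ 2)).
    rewrite mulrAC /D ler_wpM2r ?invr_ge0 ?sqr_ge0// ler_wpM2r ?mulr_ge0//.
    by lra.
  rewrite ler_pdivrMr ?exprn_gt0//; apply: (@le_trans _ _ (e0 / 8 * r)).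
    by rewrite /r mulrDr mulr1 (_ : e0 / 8 * (8 * D / e0) = D); [rewrite lerDl divr_ge0// ltW|field; rewrite gt_eqF].
  apply: ler_wpM2l; first by rewrite divr_ge0// ltW.
  by rewrite expr2 ler_peMl// ltW.
have upB (b : R) : b <= B -> b <= B' by move=> /le_trans; apply.
have errQ := trig_approximation_error mL (fun k => conj (L2 k).1 (upB _ (L2 k).2)) cf fC ep r0 tq fq qC.
have e2 : 0 < e0 / 2 by rewrite divr_gt0.
have /cvgrPdist_le/(_ _ e2) := trig_cvg tq.
move=> cq; near=> n.
have nn : (n1 <= n)%N by near: n; exact: nbhs_infty_ge.
have errP := trig_approximation_error (mX nn) (fun k => conj (X2 nn k).1 (upB _ (X2 nn k).2)) cf fC ep r0 tq fq qC.
have H : `|\int[Q]_w q (L w) - \int[P n]_w q (Xn w)| <= e0 / 2 by near: n.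
rewrite -/(Rintegral Q setT (fun w => f (L w))).
rewrite -[X in `|_ - X|]/(Rintegral (P n) setT (fun w => f (Xn w))).
move: H (le_trans errP bound) (le_trans errQ bound); rewrite !ler_norml.
by move=> /andP[? ?] /andP[? ?] /andP[? ?]; apply/andP; split; lra.
Unshelve. all: by end_near. Qed.

End weak_convergence_criterion.

(** * Gaussian limit and ridge weights *)

Section gaussian_vector.
Context d (T : measurableType d) (R : realType) (Q : probability T R).
Variables (K : nat) (Z : T -> 'cV[R]_K) (Sigma : 'M[R]_K).
Hypothesis gZ : gaussian_vector Q Z Sigma.
Hypothesis pdS : posdef Sigma.
Implicit Types (u : 'cV[R]_K) (c : R).

Let dot u w := (u^T *m Z w) 0 0.

Lemma measurable_dot u : measurable_fun setT (dot u).
Proof.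
rewrite /dot; under eq_fun do rewrite mxE.
by apply: measurable_sum => k; apply: measurable_funM => //; exact: gZ.1.
Qed.

Let sd u := Num.sqrt ((u^T *m Sigma *m u) 0 0).

Let sd_neq0 u : u != 0 -> sd u != 0.
Proof. by move=> u0; rewrite sqrtr_eq0 -ltNge; exact: pdS.2. Qed.

(** The image of [Q] under [dot u] is a normal law on the line, so these integrals reduce to
    dimension one. *)
Let transfer u (g : R -> R) : u != 0 -> measurable_fun setT g ->
  (normal_prob 0 (sd u)).-integrable setT (EFin \o g) ->
  Q.-integrable setT (EFin \o (fun w => g (dot u w))) /\
  \int[Q]_w g (dot u w) = \int[normal_prob 0 (sd u)]_x g x.
Proof.
move=> u0 mg ig; have md := measurable_dot u.
have mgE : measurable_fun setT (EFin \o g) by exact/measurable_EFinP.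
have md' : @measurable_fun _ _ T (measurableTypeR R) setT (dot u) by [].
pose nu : {measure set (measurableTypeR R) -> \bar R} :=
  measure_function_pushforward__canonical__measure_function_Measure Q md'.
have nuE A : measurable A -> nu A = normal_prob 0 (sd u) A.
  by move=> mA; rewrite -gZ.2.
have iQ : Q.-integrable setT (EFin \o (fun w => g (dot u w))).
  apply/integrableP; split; first by apply/measurable_EFinP; exact: measurableT_comp.
  move/integrableP: ig => [_]; congr (_ < _)%E.
  rewrite (eq_measure_integral nu); last by move=> A mA _; apply/esym; exact: nuE.
  rewrite (ge0_integral_pushforward md')//=.
  by apply/measurable_EFinP; exact: measurableT_comp.
split => //; rewrite /Rintegral; congr fine.
rewrite [RHS](eq_measure_integral nu); last by move=> A mA _; apply/esym; exact: nuE.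
by rewrite (integral_pushforward md').
Qed.

Lemma gaussian_vector_cos c u : \int[Q]_w cos (c + (u^T *m Z w) 0 0) =
  cos c * expR (- ((u^T *m Sigma *m u) 0 0 / 2)).
Proof.
have [->|u0] := eqVneq u 0.
  rewrite trmx0 !mul0mx mxE mul0r oppr0 expR0 mulr1.
  transitivity (\int[Q]_(w in setT) cos c); last exact: Rintegral_probability_cst.
  by apply: eq_Rintegral => w _; rewrite mul0mx mxE addr0.
have mc : measurable_fun setT (fun x : R => cos (1 * x)).
  by apply: measurable_cos_comp; exact: measurable_funM.
have ms : measurable_fun setT (fun x : R => sin (1 * x)).
  by apply: measurable_sin_comp; exact: measurable_funM.
have [ic Ec] : Q.-integrable setT (EFin \o (fun w => cos (1 * dot u w))) /\
  \int[Q]_w cos (1 * dot u w) = \int[normal_prob 0 (sd u)]_x cos (1 * x).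
  apply: (transfer (g := fun x => cos (1 * x))) => //.
  apply: (@normal_prob_integrable_bounded _ _ _ 1) => // x.
  by rewrite ler_norml cos_geN1 cos_le1.
have [is_ Es] : Q.-integrable setT (EFin \o (fun w => sin (1 * dot u w))) /\
  \int[Q]_w sin (1 * dot u w) = \int[normal_prob 0 (sd u)]_x sin (1 * x).
  apply: (transfer (g := fun x => sin (1 * x))) => //.
  apply: (@normal_prob_integrable_bounded _ _ _ 1) => // x.
  by rewrite ler_norml sin_geN1 sin_le1.
have -> : \int[Q]_w cos (c + (u^T *m Z w) 0 0) =
    \int[Q]_w (cos c * cos (1 * dot u w) - sin c * sin (1 * dot u w)).
  by apply: eq_Rintegral => w _; rewrite !mul1r -cosD.
rewrite RintegralB//; last 2 first.
- by rewrite /comp; under eq_fun do rewrite EFinM; exact: (integrableZl measurableT _ ic).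
- by rewrite /comp; under eq_fun do rewrite EFinM; exact: (integrableZl measurableT _ is_).
rewrite (RintegralZl _ measurableT ic) (RintegralZl _ measurableT is_) Ec Es.
rewrite normal_prob_sin ?sd_neq0// normal_prob_cos ?sd_neq0// mulr0 subr0.
rewrite expr1n mul1r sqr_sqrtr//; exact: ltW (pdS.2 u u0).
Qed.

Lemma gaussian_vector_square_integrable c u :
  Q.-integrable setT (EFin \o (fun w => (c + (u^T *m Z w) 0 0) ^+ 2)).
Proof.
have [->|u0] := eqVneq u 0.
  apply: (@eq_integrable _ _ _ _ _ measurableT (fun=> (c ^+ 2)%:E)).
    by move=> w _ /=; rewrite trmx0 mul0mx mxE addr0.
  exact: finite_measure_integrable_cst.
have m2 : measurable_fun setT (fun x : R => (c + x) ^+ 2).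
  by apply: measurable_funX; exact: measurable_funD.
suff : (normal_prob 0 (sd u)).-integrable setT (EFin \o (fun x : R => (c + x) ^+ 2)).
  by move=> /(transfer u0 m2)[].
have s0 := sd_neq0 u0.
have e1 := normal_prob_integrable_expR s0 1.
have e2 := normal_prob_integrable_expR s0 (-1).
have ic : (normal_prob 0 (sd u)).-integrable setT (EFin \o (fun=> 2 * c ^+ 2)).
  exact: finite_measure_integrable_cst.
(* Majorant [2 c^2 + 8 (e^x + e^-x)]: [(c + x)^2 <= 2 c^2 + 2 x^2], and [x^2 <= 4 e^|x|] by squaring
   [1 + |x| / 2 <= e^(|x| / 2)]. *)
have ie := integrableD measurableT ic
  (integrableZl measurableT 8 (integrableD measurableT e1 e2)).
apply: (le_integrable measurableT _ _ ie); first exact/measurable_EFinP.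
move=> x _ /=; rewrite lee_fin.
apply: le_trans (ler_norm _); rewrite ger0_norm ?sqr_ge0//.
have H (t : R) : 0 <= t -> t ^+ 2 / 4 <= expR t.
  move=> t0; rewrite [t in expR t](_ : t = t / 2 + t / 2); last by field.
  by rewrite expRD; have := expR_ge1Dx (t / 2); move: (expR _) => E; nra.
have := expR_ge0 (1 * x); have := expR_ge0 (-1 * x); rewrite mul1r mulN1r.
have := sqr_ge0 (c - x).
have [x0|x0] := leP 0 x; first by have := H _ x0; move=> *; nra.
have := H (- x); rewrite oppr_ge0 sqrrN => /(_ (ltW x0)); move=> *; nra.
Qed.

End gaussian_vector.

(** * Entrywise limits of matrices *)

Section matrix_limits.
Variables (R : realType).

Lemma cvg_mx_entry m n (A : nat -> 'M[R]_(m, n)) (A0 : 'M[R]_(m, n)) i j :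
  A k @[k --> \oo] --> A0 -> A k i j @[k --> \oo] --> A0 i j.
Proof.
move=> AA; apply: (@cvg_comp _ _ _ A (fun M : 'M[R]_(m, n) => M i j) _ _ _ AA).
exact: coord_continuous.
Qed.

Definition entrywise_cvg m n (A : nat -> 'M[R]_(m, n)) (A0 : 'M[R]_(m, n)) :=
  forall i j, A k i j @[k --> \oo] --> A0 i j.

Lemma entrywise_cvg_mulmx m n p (A : nat -> 'M[R]_(m, n)) (B : nat -> 'M[R]_(n, p)) A0 B0 :
  entrywise_cvg A A0 -> entrywise_cvg B B0 ->
  entrywise_cvg (fun k => A k *m B k) (A0 *m B0).
Proof.
move=> AA BB i j; rewrite mxE; under eq_fun do rewrite mxE.
by apply: cvg_sumr => l; apply: cvgM; [exact: AA|exact: BB].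
Qed.

Lemma entrywise_cvg_tr m n (A : nat -> 'M[R]_(m, n)) A0 :
  entrywise_cvg A A0 -> entrywise_cvg (fun k => (A k)^T) A0^T.
Proof. by move=> AA i j; rewrite mxE; under eq_fun do rewrite mxE; exact: AA. Qed.

Lemma entrywise_cvg_cst m n (A0 : 'M[R]_(m, n)) : entrywise_cvg (fun=> A0) A0.
Proof. by move=> i j; exact: cvg_cst. Qed.

Lemma cvg_det n (A : nat -> 'M[R]_n) A0 :
  entrywise_cvg A A0 -> \det (A k) @[k --> \oo] --> \det A0.
Proof.
move=> AA; apply: cvg_sumr => s; apply: cvgM; first exact: cvg_cst.
by apply: cvg_prodr => i; exact: AA.
Qed.

(** Cramer's rule expresses each entry through determinants, which are continuous in the entries.
    Invertibility along the sequence selects the branch of [invmx] that is the true inverse. *)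
Lemma entrywise_cvg_invmx n (A : nat -> 'M[R]_n) A0 n1 :
  entrywise_cvg A A0 -> A0 \in unitmx ->
  (forall k, (n1 <= k)%N -> A k \in unitmx) ->
  entrywise_cvg (fun k => invmx (A k)) (invmx A0).
Proof.
move=> AA uA0 uA i j; rewrite /invmx uA0 !mxE.
apply: (@cvg_trans _ (((\det (A k))^-1 * cofactor (A k) j i) @[k --> \oo])).
  apply: near_eq_cvg; near=> k; rewrite uA ?mxE//.
  by near: k; exact: nbhs_infty_ge.
apply: cvgM.
  by apply: cvgV; [rewrite -unitfE|exact: cvg_det].
apply: cvgM; first exact: cvg_cst.
apply: cvg_det => a b; rewrite !mxE.
by under eq_fun do rewrite !mxE; exact: AA.
Unshelve. all: by end_near. Qed.

Lemma quadratic_form_unitmx n (A : 'M[R]_n) :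
  (forall u : 'cV[R]_n, u != 0 -> 0 < (u^T *m A *m u) 0 0) -> A \in unitmx.
Proof.
move=> pA; rewrite -row_free_unit -kermx_eq0; apply/negPn/negP => /rowV0Pn[v].
move=> /sub_kermxP vA v0; have := pA v^T.
by rewrite trmxK vA mul0mx mxE ltxx trmx_eq0 => /(_ v0).
Qed.

Lemma invmx_diag n (g : 'cV[R]_n) : (forall k, g k 0 != 0) ->
  invmx (diag_mx g^T) = diag_mx (\row_k (g k 0)^-1).
Proof.
move=> g0; have E : diag_mx g^T *m diag_mx (\row_k (g k 0)^-1) = 1%:M.
  rewrite mulmx_diag; apply/matrixP => i j; rewrite !mxE.
  by case: eqP => // _; rewrite divff.
have [u _] := mulmx1_unit E.
by rewrite -[RHS](mulKmx u) E mulmx1.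
Qed.

End matrix_limits.

Lemma cvg_near_dist (R : realType) (f g h : nat -> R) (l : R) :
  (\forall n \near \oo, `|f n - g n| <= h n) ->
  g n @[n --> \oo] --> l -> h n @[n --> \oo] --> 0 -> f n @[n --> \oo] --> l.
Proof.
move=> fgh gl h0; apply/cvgrPdist_le => e e0; have e2 : 0 < e / 2 by rewrite divr_gt0.
have /cvgrPdist_le/(_ _ e2) gl' := gl; have /cvgrPdist_le/(_ _ e2) h0' := h0.
near=> n.
have H1 : `|f n - g n| <= h n by near: n.
have H2 : `|l - g n| <= e / 2 by near: n.
have H3 : `|0 - h n| <= e / 2 by near: n.
rewrite sub0r normrN in H3; have H4 := le_trans H1 (le_trans (ler_norm _) H3).
move: H2 H4; rewrite !ler_norml => /andP[? ?] /andP[? ?].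
by apply/andP; split; lra.
Unshelve. all: by end_near. Qed.

(** * The ridge estimator and the weights of the errors in it *)

Section ridge_regression.
Variables (R : realType) (n K : nat) (X : 'M[R]_(n, K)) (gamma : 'cV[R]_K).
Hypothesis n_gt0 : (0 < n)%N.
Hypothesis gamma_gt0 : forall k, 0 < gamma k 0.

Let nR : 0 < n%:R :> R. Proof. by rewrite ltr0n. Qed.
Let S : 'M[R]_K := n%:R^-1 *: (X^T *m X).
Let A : 'M[R]_K := S + invmx (diag_mx gamma^T).

Lemma ridge_unitmx : posdef (X^T *m X) -> A \in unitmx.
Proof.
move=> pX; apply: quadratic_form_unitmx => u u0.
have gn k : gamma k 0 != 0 by rewrite gt_eqF.
rewrite /A mulmxDr mulmxDl mxE ltr_pwDl//.
  rewrite /S -scalemxAr -scalemxAl mxE mulr_gt0 ?invr_gt0//; exact: pX.2.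
rewrite invmx_diag// mxE; apply: sumr_ge0 => k _.
by rewrite mul_mx_diag !mxE mulrAC mulr_ge0 -?expr2 ?sqr_ge0// invr_ge0 ltW.
Qed.

Lemma posterior_mean_ridge (y : 'cV[R]_n) : A \in unitmx ->
  posterior_mean X n%:R gamma y = invmx A *m (n%:R^-1 *: (X^T *m y)).
Proof.
move=> uA; have : A *m (invmx A *m (n%:R^-1 *: (X^T *m y))) = n%:R^-1 *: (X^T *m y).
  by rewrite mulKVmx.
move: (invmx A *m _) => mm AM; have gn k : gamma k 0 != 0 by rewrite gt_eqF.
rewrite (@posterior_mean_normal_equation R n K X n%:R gamma y nR gamma_gt0 (fun j => mm j 0)).
  by apply/matrixP => i j; rewrite mxE ord1.
move=> j; move: AM; rewrite /A mulmxDl invmx_diag// => /matrixP/(_ j 0).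
rewrite mul_diag_mx /S -scalemxAl -mulmxA !mxE => E.
have -> : \sum_i X i j * (y i 0 - \sum_l X i l * mm l 0) =
    \sum_i X^T j i * y i 0 - \sum_i X^T j i * (X *m mm) i 0.
  by rewrite -sumrB; apply: eq_bigr => i _; rewrite !mxE mulrBr.
by rewrite mulrBl ![_ / n%:R]mulrC -E [LHS]mulrC addrAC subrr add0r.
Qed.

Variable beta0 : 'cV[R]_K.
Variable u : 'cV[R]_K.
Let v : 'rV[R]_K := u^T *m invmx A.

(** The scale [Num.sqrt n%:R] of the responses against the factor [1 / n] of the ridge formula
    leaves [1 / Num.sqrt n%:R]. *)
Definition ridge_weight (i : 'I_n) : R := (v *m X^T) 0 i / Num.sqrt n%:R.

Lemma posterior_mean_dot (e : 'I_n -> R) : A \in unitmx ->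
  (u^T *m posterior_mean X n%:R gamma
     (\col_i (Num.sqrt n%:R * ((X *m beta0) i 0 / Num.sqrt n%:R + e i)))) 0 0 =
  (v *m (S *m beta0)) 0 0 + \sum_i ridge_weight i * e i.
Proof.
move=> uA; rewrite posterior_mean_ridge//.
have sn : Num.sqrt n%:R != 0 :> R by rewrite sqrtr_eq0 -ltNge.
have -> : \col_i (Num.sqrt n%:R * ((X *m beta0) i 0 / Num.sqrt n%:R + e i)) =
    X *m beta0 + Num.sqrt n%:R *: \col_i e i.
  apply/matrixP => i j; rewrite [j]ord1 mxE [RHS]mxE [X in _ = _ + X]mxE [X in _ = _ + _ * X]mxE.
  by rewrite mulrDr mulrCA divff// mulr1.
rewrite [u^T *m (_ *m _)]mulmxA -/v /ridge_weight /S; move: v => w.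
rewrite mulmxDr scalerDr mulmxDr [LHS]mxE; congr (_ + _).
  by rewrite mulmxA -scalemxAl.
rewrite -!scalemxAr scalerA mulmxA [LHS]mxE [X in _ * X = _]mxE mulr_sumr.
apply: eq_bigr => i _; rewrite [X in _ * (_ * X)]mxE mulrA; congr (_ * _).
rewrite mulrC; congr (_ * _).
by rewrite -[X in X^-1 * _](@sqr_sqrtr _ n%:R) ?ltW// expr2 invfM -mulrA mulVf ?mulr1.
Qed.

Lemma ridge_weight_sqr : \sum_i ridge_weight i ^+ 2 = (v *m S *m v^T) 0 0.
Proof.
have -> : v *m S *m v^T = n%:R^-1 *: ((v *m X^T) *m (v *m X^T)^T).
  by move: v => w; rewrite trmx_mul trmxK /S -scalemxAr -scalemxAl !mulmxA.
rewrite [RHS]mxE [X in _ = _ * X]mxE mulr_sumr.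
apply: eq_bigr => i _; rewrite /ridge_weight exprMn exprVn sqr_sqrtr ?ltW// mulrC expr2.
by rewrite [X in _ = _ * (_ * X)]mxE.
Qed.

(** Each entry of a row is at most its Euclidean norm. The weights thus vanish uniformly in [i] as
    long as [v] stays bounded. *)
Lemma ridge_weight_le i :
  `|ridge_weight i| <= (\sum_k `|v 0 k|) * max_row_ratio X.
Proof.
have sn : 0 < Num.sqrt n%:R :> R by rewrite sqrtr_gt0.
rewrite /ridge_weight normrM normfV (gtr0_norm sn).
apply: (@le_trans _ _ ((\sum_k `|v 0 k|) * (eucl_norm (row i X) / Num.sqrt n%:R))).
  rewrite mulrA; apply: ler_wpM2r; first by rewrite invr_ge0 ltW.
  rewrite mxE; apply: le_trans (ler_norm_sum _ _ _) _; rewrite mulr_suml.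
  apply: ler_sum => k _; rewrite normrM !mxE ler_wpM2l//.
  rewrite /eucl_norm -sqrtr_sqr ler_wsqrtr// (bigD1 k)//= !mxE lerDl.
  by apply: sumr_ge0 => j _; exact: sqr_ge0.
apply: ler_wpM2l; first by apply: sumr_ge0 => k _; exact: normr_ge0.
exact: (le_bigmax _ (fun i => eucl_norm (row i X) / Num.sqrt n%:R)).
Qed.

End ridge_regression.

(** * Limits of the weights and of the cosine transforms, and the conclusion *)

Theorem theorem4 (R : realType) (K : nat) (HK : (0 < K)%N)
  (beta0 : 'cV[R]_K) (X : forall n : nat, 'M[R]_(n, K)) (Sigma0 : 'M[R]_K)
  (gamma0 : 'cV[R]_K) (M : R)
  (d : nat -> measure_display) (Omega : forall n, measurableType (d n))
  (P : forall n, probability (Omega n) R)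
  (eps : forall n : nat, 'I_n -> Omega n -> R) :
  (* (i) and (iii): for each n (large enough that they can hold) *)
  (exists n0 : nat, forall n : nat, (n0 <= n)%N ->
     (forall k : 'I_K, \sum_(i < n) X n i k = 0 /\
                       \sum_(i < n) X n i k ^+ 2 = n%:R) /\
     posdef ((X n)^T *m X n)) ->
  (* (ii) *)
  (fun n => max_row_ratio (X n)) @ \oo --> (0 : R) ->
  (* (iv) *)
  (fun n => (n%:R)^-1 *: ((X n)^T *m X n)) @ \oo --> Sigma0 ->
  posdef Sigma0 ->
  (* errors *)
  (forall n, mutually_independent (P n) (eps n)) ->
  (forall n (i : 'I_n), measurable_fun setT (eps n i)) ->
  (forall n (i : 'I_n), ('E_(P n)[eps n i] = 0)%E) ->
  (forall n (i : 'I_n), ('E_(P n)[fun w => (eps n i w ^+ 2)%R] = 1)%E) ->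
  (forall n (i : 'I_n), ('E_(P n)[fun w => (eps n i w ^+ 4)%R] <= M%:E)%E) ->
  (* prior hyperparameters *)
  (forall k : 'I_K, 0 < gamma0 k 0) ->
  let Y := fun n (i : 'I_n) (w : Omega n) =>
             (X n *m beta0) i 0 / Num.sqrt n%:R + eps n i w in
  let Ystar := fun n (w : Omega n) => \col_(i < n) (Num.sqrt n%:R * Y n i w) in
  let betahat := fun n (w : Omega n) =>
                   posterior_mean (X n) n%:R gamma0 (Ystar n w) in
  let Gamma0 := diag_mx gamma0^T in
  forall d' (Omega' : measurableType d') (Q : probability Omega' R)
         (Z : Omega' -> 'cV[R]_K),
    gaussian_vector Q Z Sigma0 ->
    cvg_in_distribution P betahat Q
      (fun w => invmx (Sigma0 + invmx Gamma0) *m (Sigma0 *m beta0 + Z w)).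
Proof.
move=> [n0 hX] ratio0 Scvg pdS ieps meps eps1 eps2 eps4 gam0 Y Ystar betahat Gamma0.
move=> d' Omega' Q Z gZ.
have {}eps1 n i : (\int[P n]_w (eps n i w)%:E = 0)%E by have := eps1 n i; rewrite unlock.
have {}eps2 n i : (\int[P n]_w (eps n i w ^+ 2)%:E = 1)%E by have := eps2 n i; rewrite unlock.
have {}eps4 n i : (\int[P n]_w (eps n i w ^+ 4)%:E <= M%:E)%E by have := eps4 n i; rewrite unlock.
have M0 : 0 <= M.
  rewrite -lee_fin; apply: le_trans (eps4 1%N ord0); apply: integral_ge0 => w _.
  by rewrite lee_fin exprn_even_ge0.
(* The 1 keeps [n%:R] invertible; from [n0] on the design conditions hold. *)
pose N := maxn n0 1.
have N0 n : (N <= n)%N -> (n0 <= n)%N by apply: leq_trans; exact: leq_maxl.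
have N1 n : (N <= n)%N -> (0 < n)%N by apply: leq_trans; exact: leq_maxr.
pose S n : 'M[R]_K := n%:R^-1 *: ((X n)^T *m X n).
pose A n := S n + invmx Gamma0; pose A0 := Sigma0 + invmx Gamma0.
have uA n : (N <= n)%N -> A n \in unitmx.
  by move=> Nn; apply: ridge_unitmx => //; [exact: N1|exact: (hX n (N0 n Nn)).2].
have gn k : gamma0 k 0 != 0 by rewrite gt_eqF.
have uA0 : A0 \in unitmx.
  apply: quadratic_form_unitmx => u u0; rewrite /A0 mulmxDr mulmxDl mxE ltr_pwDl//; first exact: pdS.2.
  rewrite invmx_diag// mxE; apply: sumr_ge0 => k _.
  by rewrite mul_mx_diag !mxE mulrAC mulr_ge0 -?expr2 ?sqr_ge0// invr_ge0 ltW.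
have SE : entrywise_cvg S Sigma0 by move=> i j; exact: cvg_mx_entry Scvg.
have AE : entrywise_cvg A A0.
  move=> i j; rewrite /A /A0 mxE; under eq_fun do rewrite mxE.
  by apply: (@cvgD _ R^o); [exact: SE|exact: cvg_cst].
have IE := entrywise_cvg_invmx AE uA0 uA.
pose v (u : 'cV[R]_K) n : 'rV[R]_K := u^T *m invmx (A n).
pose v0 (u : 'cV[R]_K) : 'rV[R]_K := u^T *m invmx A0.
have vE u : entrywise_cvg (v u) (v0 u).
  by apply: entrywise_cvg_mulmx => //; exact: entrywise_cvg_cst.
pose cn u n := (v u n *m (S n *m beta0)) 0 0.
pose c0 u := (v0 u *m (Sigma0 *m beta0)) 0 0.
have cE u : cn u n @[n --> \oo] --> c0 u.
  apply: entrywise_cvg_mulmx => //; apply: entrywise_cvg_mulmx => //.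
  exact: entrywise_cvg_cst.
pose sn u n := (v u n *m S n *m (v u n)^T) 0 0.
pose s0 u := (v0 u *m Sigma0 *m (v0 u)^T) 0 0.
have sE u : sn u n @[n --> \oo] --> s0 u.
  apply: entrywise_cvg_mulmx; last exact: entrywise_cvg_tr.
  exact: entrywise_cvg_mulmx.
pose a u n := @ridge_weight R n K (X n) gamma0 u.
have dotE u n w : (N <= n)%N -> (u^T *m betahat n w) 0 0 = cn u n + partial_sum (eps n) (a u n) n w.
  move=> Nn; rewrite partial_sumT.
  exact: (posterior_mean_dot (N1 n Nn) gam0 beta0 u (fun i => eps n i w) (uA n Nn)).
have aE u n : (N <= n)%N -> \sum_(i < n | (i < n)%N) a u n i ^+ 2 = sn u n.
  move=> Nn; rewrite (eq_bigl xpredT) => [|i]; last by rewrite ltn_ord.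
  exact: ridge_weight_sqr (N1 n Nn) u.
have s_ge0 u n : (N <= n)%N -> 0 <= sn u n.
  by move=> Nn; rewrite -aE//; apply: sumr_ge0 => i _; exact: sqr_ge0.
have mS n (Nn : (N <= n)%N) u : measurable_fun setT (partial_sum (eps n) (a u n) n).
  exact: measurable_partial_sum.
have moments n u := partial_sum_moments (meps n) (ieps n) (eps1 n) (eps2 n) (a u n) (leqnn n).
pose e_ (k : 'I_K) : 'cV[R]_K := delta_mx k 0.
have eE k (x : 'cV[R]_K) : x k 0 = ((e_ k)^T *m x) 0 0.
  by rewrite trmx_delta -rowE mxE.
have sqE n u w : (cn u n + partial_sum (eps n) (a u n) n w) ^+ 2 =
    cn u n ^+ 2 + ((2 * cn u n) * partial_sum (eps n) (a u n) n w +
    partial_sum (eps n) (a u n) n w ^+ 2) by ring.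
have second u n : (N <= n)%N ->
    (P n).-integrable setT (EFin \o (fun w => (cn u n + partial_sum (eps n) (a u n) n w) ^+ 2)) /\
    \int[P n]_w (cn u n + partial_sum (eps n) (a u n) n w) ^+ 2 = cn u n ^+ 2 + sn u n.
  move=> Nn; have [i1 i2 E1 E2] := moments n u.
  under eq_fun do rewrite sqE.
  have iz : (P n).-integrable setT
      (EFin \o (fun w => (2 * cn u n) * partial_sum (eps n) (a u n) n w)).
    by rewrite /comp; under eq_fun do rewrite EFinM; exact: (integrableZl measurableT _ i1).
  have ic : (P n).-integrable setT (EFin \o (fun=> cn u n ^+ 2)).
    exact: finite_measure_integrable_cst.
  have iD : (P n).-integrable setT (EFin \o (fun w =>
      (2 * cn u n) * partial_sum (eps n) (a u n) n w + partial_sum (eps n) (a u n) n w ^+ 2)).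
    by rewrite /comp; under eq_fun do rewrite EFinD; exact: (integrableD measurableT iz i2).
  split.
    by rewrite /comp; under eq_fun do rewrite EFinD; exact: (integrableD measurableT ic iD).
  rewrite (RintegralD measurableT ic iD) (RintegralD measurableT iz i2).
  by rewrite (RintegralZl _ measurableT i1) E1 E2 mulr0 add0r Rintegral_probability_cst aE.
pose L w := invmx A0 *m (Sigma0 *m beta0 + Z w).
have LE u w : (u^T *m L w) 0 0 = c0 u + (((v0 u)^T)^T *m Z w) 0 0.
  by rewrite /L mulmxA -/(v0 u) mulmxDr mxE trmxK.
have mL k : measurable_fun setT (fun w => L w k 0).
  under eq_fun do rewrite eE LE.
  by apply: measurable_funD => //; exact: measurable_dot gZ _.
have L2 k : Q.-integrable setT (EFin \o (fun w => L w k 0 ^+ 2)).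
  rewrite /comp; under eq_fun do rewrite eE LE.
  exact: gaussian_vector_square_integrable gZ pdS _ _.
(* A single convergent sequence that dominates the second moments of all coordinates at once. *)
pose tot n := \sum_k (cn (e_ k) n ^+ 2 + sn (e_ k) n).
pose tot0 := \sum_k (c0 (e_ k) ^+ 2 + s0 (e_ k)).
have totE : tot n @[n --> \oo] --> tot0.
  apply: cvg_sumr => k; apply: (@cvgD _ R^o); last exact: sE.
  by rewrite expr2; under eq_fun do rewrite expr2; apply: cvgM; exact: cE.
have /cvgrPdist_le/(_ 1 ltr01)[N2 _ totP] := totE.
pose B := Num.max (tot0 + 1) (\sum_k \int[Q]_w L w k 0 ^+ 2).
apply: (@cvg_in_distribution_cos R K d Omega P betahat d' Omega' Q L (maxn N N2) B).
- move=> n; rewrite geq_max => /andP[Nn _] k.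
  under eq_fun do rewrite eE dotE//.
  by apply: measurable_funD => //; exact: mS.
- exact: mL.
- move=> n; rewrite geq_max => /andP[Nn N2n] k.
  have [i2 E2] := second (e_ k) n Nn.
  have H : (fun w => betahat n w k 0 ^+ 2) =
      (fun w => (cn (e_ k) n + partial_sum (eps n) (a (e_ k) n) n w) ^+ 2).
    by apply/funext => w; rewrite eE dotE.
  rewrite H; split => //; rewrite E2 le_max; apply/orP; left.
  have := totP n N2n; rewrite /= ler_norml => /andP[h1 _].
  apply: (@le_trans _ _ (tot n)); last by lra.
  rewrite /tot (bigD1 k)//= lerDl; apply: sumr_ge0 => j _.
  by rewrite addr_ge0 ?sqr_ge0// s_ge0.
- move=> k; split; first exact: L2.
  rewrite le_max; apply/orP; right; rewrite (bigD1 k)//= lerDl.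
  by apply: sumr_ge0 => j _; apply: Rintegral_ge0 => w _; exact: sqr_ge0.
move=> c u.
(* The limit is affine in [Z]: the shift [c0 u] joins the phase, and [(v0 u)^T] is the direction in
   which [Z] is tested. *)
have -> : \int[Q]_w cos (c + (u^T *m L w) 0 0) = cos (c + c0 u) * expR (- (s0 u / 2)).
  under eq_Rintegral do rewrite LE addrA.
  by rewrite (gaussian_vector_cos gZ pdS) trmxK.
pose mu n := (\sum_k `|v u n 0 k|) * max_row_ratio (X n).
have muE : mu n @[n --> \oo] --> 0.
  rewrite -[X in _ --> X](mulr0 (\sum_k `|v0 u 0 k|)); apply: cvgM => //.
  by apply: cvg_sumr => k; apply: cvg_norm; exact: vE.
(* With all weights at most [mu n], the sum of their fourth powers and cubes is at most [mu^2 + mu]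
   times the sum of squares [sn u n], which converges while [mu n] tends to 0. *)
apply: (@cvg_near_dist _ _ (fun n => cos (c + cn u n) * expR (- (sn u n / 2)))
  (fun n => (M + 3) * (mu n * mu n + mu n) * sn u n)).
- exists N => // n /= Nn.
  have -> : \int[P n]_w cos (c + (u^T *m betahat n w) 0 0) =
      \int[P n]_w cos (c + cn u n + partial_sum (eps n) (a u n) n w).
    by apply: eq_Rintegral => w _; rewrite dotE// addrA.
  have := partial_sum_cos (meps n) (ieps n) (eps1 n) (eps2 n) (eps4 n) (a u n) (c + cn u n) (leqnn n).
  rewrite aE// => H; apply: le_trans H _.
  rewrite -aE// mulr_sumr; apply: ler_sum => i _.
  have : `|a u n i| <= mu n by apply: ridge_weight_le; exact: N1.
  have -> : a u n i ^+ 4 = `|a u n i| ^+ 4.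
    by rewrite -normrX ger0_norm// exprn_even_ge0.
  have -> : a u n i ^+ 2 = `|a u n i| ^+ 2.
    by rewrite -normrX ger0_norm// sqr_ge0.
  have := normr_ge0 (a u n i); move: `|a u n i| (mu n) => x m x0 xm.
  rewrite -mulrDr -mulrA ler_wpM2l ?addr_ge0//.
  have -> : x ^+ 4 + x ^+ 3 = (x * x + x) * x ^+ 2 by ring.
  by rewrite ler_wpM2r ?sqr_ge0// lerD// ler_pM.
- apply: cvgM.
    apply: (@cvg_comp _ _ _ (fun n => c + cn u n) (@cos R)); last exact: continuous_cos.
    by apply: (@cvgD _ R^o); [exact: cvg_cst|exact: cE].
  apply: (@cvg_comp _ _ _ (fun n => - (sn u n / 2)) (@expR R)); last exact: continuous_expR.
  by apply: (@cvgN _ R^o); apply: cvgM; [exact: sE|exact: cvg_cst].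
- rewrite -[X in _ --> X](mul0r (s0 u)); apply: cvgM; last exact: sE.
  rewrite -[X in _ --> X](mulr0 (M + 3)); apply: cvgM; first exact: cvg_cst.
  rewrite -[X in _ --> X]addr0; apply: (@cvgD _ R^o) => //.
  by rewrite -[X in _ --> X](mulr0 0); exact: cvgM.
Qed.
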